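(* Let $\Omega$ be the open unit ball of $\mathbb{R}^2$ and let $\mathcal{K}\ge 2$ be an integer. Then there exists $p^*=p^*(\mathcal{K})$ such that for every $p>1$ with $p>p^*$ the following holds: if $u$ is a radial solution of $-\Delta u=|u|^{p-1}u$ in $\Omega$, $u=0$ on $\partial\Omega$, having exactly $\mathcal{K}$ nodal regions and with $u(0)>0$, and if $\varphi_1$ is a positive first eigenfunction of the linearized operator $L\varphi=-\Delta\varphi-p|u|^{p-1}\varphi$ with domain $H^2(\Omega)\cap H^1_0(\Omega)$, then $$\int_\Omega u\,\varphi_1\,dx>0.$$
   Context: The nodal regions of $u$ are the connected components of $\{x\in\Omega: u(x)\ne0\}$. For every $p>1$ and every integer $\mathcal{K}\ge1$ there is a unique radial solution $u\in C^2(\overline\Omega)$ with exactly $\mathcal{K}$ nodal regions and $u(0)>0$. The first eigenfunction of the self-adjoint operator $L$ on $L^2(\Omega)$ is the eigenfunction associated with its smallest eigenvalue; it is unique up to scalar multiples and can be chosen positive. *)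

(* Defs.v *)
From HB Require Import structures.
From mathcomp Require Import all_boot all_order all_algebra.
From mathcomp Require Import all_classical all_reals all_analysis.

Set Implicit Arguments.
Unset Strict Implicit.
Unset Printing Implicit Defensive.

Import Order.TTheory GRing.Theory Num.Theory.
Import numFieldNormedType.Exports.

Local Open Scope classical_set_scope.
Local Open Scope ring_scope.

Section LaneEmdenDisk.
Context {R : realType}.

(* The library's norm on [R * R] is the sup norm, so the Euclidean one is
   spelled out; both induce the same topology. *)
Definition enorm (x : R * R) : R := Num.sqrt (x.1 ^+ 2 + x.2 ^+ 2).

Definition Omega : set (R * R) := [set x | enorm x < 1].

(* On the Borel sets of the plane; by [{ae leb2, _}], null sets are, as usual,
   all subsets of Borel sets of measure zero. [measurableTypeR R] is the alias of
   [R] on which [lebesgue_measure] lives. *)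
Definition leb2 :
    {measure set (measurableTypeR R * measurableTypeR R) -> \bar R} :=
  ((@lebesgue_measure R) \x (@lebesgue_measure R))%E.

(* Coordinate directions are indexed by booleans: [false] is the first
   coordinate and [true] the second one. *)
Definition edir (i : bool) : R * R := if i then (0, 1) else (1, 0).

(* Iterated partial derivative along a list of directions; the head of the list
   is the outermost (last) differentiation. *)
Definition pd (s : seq bool) (f : R * R -> R) : R * R -> R :=
  foldr (fun i g => fun x => 'D_(edir i) g x) f s.

Definition Ck_on (k : nat) (U : set (R * R)) (f : R * R -> R) : Prop :=
  (forall s i x, (size s < k)%N -> U x -> derivable (pd s f) x (edir i)) /\
  (forall s x, (size s <= k)%N -> U x -> {for x, continuous (pd s f)}).

(* C^2 up to the boundary: the derivatives of order at most two in the open disk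
   extend continuously to the closed disk, the extension of [u] being [u]. The
   values of [u] outside the closed disk are irrelevant. *)
Definition C2_closure (u : R * R -> R) : Prop :=
  [/\ Ck_on 2 Omega u,
      {within closure Omega, continuous u} &
      forall s, (size s <= 2)%N -> exists h : R * R -> R,
        {within closure Omega, continuous h} /\
        {in Omega, forall x, h x = pd s u x}].

Definition laplacian (u : R * R -> R) (x : R * R) : R :=
  \sum_(i : bool) pd [:: i; i] u x.

Definition radial (u : R * R -> R) : Prop :=
  forall x y, closure Omega x -> closure Omega y -> enorm x = enorm y ->
    u x = u y.

Definition lane_emden_solution (p : R) (u : R * R -> R) : Prop :=
  [/\ C2_closure u,
      forall x, Omega x -> - laplacian u x = `|u x| `^ (p - 1) * u x &
      forall x, (closure Omega `\` Omega) x -> u x = 0].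

Definition nodal_regions (u : R * R -> R) : set (set (R * R)) :=
  let N := [set x | Omega x /\ u x != 0] in connected_component N @` N.

(* Elements of the spaces below are represented by functions on the plane of
   which only the (almost everywhere) values on [Omega] matter. *)
Definition L2 (f : R * R -> R) : Prop := f \_ Omega \in Lfun leb2 2%:E.

Definition L2dist (f g : R * R -> R) : \bar R :=
  'N[leb2]_2%:E [EFin \o (f \- g) \_ Omega].

Definition test_function (f : R * R -> R) : Prop :=
  (forall k, Ck_on k setT f) /\
  exists K : set (R * R),
    [/\ compact K, K `<=` Omega & forall x, ~ K x -> f x = 0].

(* [g] is the weak derivative of [f] along [s] in [Omega], and lies in L^2. *)
Definition weak_pd (s : seq bool) (f g : R * R -> R) : Prop :=
  L2 g /\
  forall t, test_function t ->
    \int[leb2]_(x in Omega) (f x * pd s t x) =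
    (-1) ^+ size s * \int[leb2]_(x in Omega) (g x * t x).

Definition H2 (f : R * R -> R) : Prop :=
  L2 f /\ forall s, (size s <= 2)%N -> exists g, weak_pd s f g.

(* Closure of the test functions in the H^1 norm. *)
Definition H10 (f : R * R -> R) : Prop :=
  L2 f /\ exists g : bool -> R * R -> R,
    (forall i, weak_pd [:: i] f (g i)) /\
    (forall e : R, 0 < e -> exists t,
      [/\ test_function t, (L2dist f t < e%:E)%E &
          forall i, (L2dist (g i) (pd [:: i] t) < e%:E)%E]).

(* Graph of the operator L on L^2(Omega), with domain H^2 and H^1_0. *)
Definition linearized_op (p : R) (u f h : R * R -> R) : Prop :=
  [/\ H2 f, H10 f, L2 h & exists g : bool -> R * R -> R,
    (forall i, weak_pd [:: i; i] f (g i)) /\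
    {ae leb2, forall x, Omega x ->
       h x = - (\sum_(i : bool) g i x) - p * `|u x| `^ (p - 1) * f x}].

Definition eigenfunction (p : R) (u : R * R -> R) (lambda : R)
    (f : R * R -> R) : Prop :=
  linearized_op p u f (fun x => lambda * f x) /\
  ~ {ae leb2, forall x, Omega x -> f x = 0}.

Definition first_eigenfunction (p : R) (u f : R * R -> R) : Prop :=
  exists lambda, eigenfunction p u lambda f /\
    forall mu g, eigenfunction p u mu g -> lambda <= mu.

End LaneEmdenDisk.

(* Main.v *)
(** Let [mu] be minus the first eigenvalue, [V = p |u|^(p-1)] and [phi] the
    positive first eigenfunction. For a radial [T] of class [C^2] vanishing on
    the unit circle, Green's formula gives [int phi (lap T + V T - mu T) = 0].
    Since [phi] is only a limit of test functions in the [H^1] norm, this is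
    obtained from the ramps [max (b - |x|^2, 0)], of which piecewise linear
    interpolants of [T] in the variable [|x|^2] are combinations.
    - With [k = p u(0)^(p-1)], the function [exp (-16 / h)], where
      [h = 1 - k |x|^2 / 80 > 0], is a compactly supported subsolution, whence
      [mu >= k / 100].
    - The energy of the radial equation is nonincreasing and a Pohozaev
      functional is nonpositive up to the first zero, whence [u >= - M] with
      [M^(p+1) = 2 u(0)^(p+1) / (p + 1)]; for large [p] this makes
      [2 p M^(p-1) < mu].
    - For [T = M (1 - |x|^(2n)) - u] the formula reads
      [mu int u phi = int phi B] with [B = (p - 1) |u|^(p-1) u +
      M (4 n^2 |x|^(2n-2) + (mu - V) (1 - |x|^(2n)))], and [B > 0] by Young's
      inequality once [4 n^2 >= (p - 1) M^(p-1)]. *)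

Require Import Defs.
From mathcomp Require Import all_boot all_order all_algebra.
From mathcomp Require Import all_classical all_reals all_analysis.
From mathcomp Require Import measurable_realfun ring lra.

Set Implicit Arguments.
Unset Strict Implicit.
Unset Printing Implicit Defensive.

Import Order.TTheory GRing.Theory Num.Theory.
Import numFieldNormedType.Exports.

Local Open Scope classical_set_scope.
Local Open Scope ring_scope.

(** * Integration over the disk *)

Section Plane.
Context {R : realType}.
Local Notation plane := (measurableTypeR R * measurableTypeR R)%type.

(** [phi] is known only almost everywhere and through weak derivatives, so all information on it is
    read off integrals of [phi] against explicit functions of known sign. Green's formula is cut
    into two halves that meet at the integral of grad phi . grad T: one replaces [phi] by test
    functions, the other replaces [T], which merely vanishes on the circle, by test functions. With
    T = u alone the formula reads mu int u phi = (p - 1) int |u|^(p-1) u phi, whose integrand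
    changes sign. The barrier M (1 - |x|^(2n)) repairs this: inside the disk it is close to M, and
    mu M pays for the negative values of u; near the circle, where it fades, its Laplacian pays.
    What is needed is that mu dominates p M^(p-1), and both are measured against k. On the scale
    |x|^2 ~ 1 / k the inequality u >= u(0) (1 - k |x|^2 / (4 p)) keeps V, hence mu, at least of the
    order of k, whereas (M / u(0))^(p-1) tends to 0 as p grows. *)

Lemma ball_prodE (x : R * R) (e : R) : ball x e = ball x.1 e `*` ball x.2 e.
Proof. by []. Qed.

(** Balls of the sup norm are rectangles, and an open set is the union of the countably many balls
    with rational centre and radius [1 / (n + 1)] that it contains. *)
Lemma open_plane_measurable (U : set (R * R)) :
  open U -> @measurable _ plane U.
Proof.
move=> oU.
pose q (c : rat * rat * nat) : R * R := (ratr c.1.1, ratr c.1.2).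
pose e (c : rat * rat * nat) : R := c.2.+1%:R^-1.
have -> : U = \bigcup_(c in [set c | ball (q c) (e c) `<=` U]) ball (q c) (e c).
  apply/seteqP; split => [x Ux|x [c cU] /cU //].
  have [r/= r0 rU] := open_subball oU Ux.
  have [n nr] : exists n, n.+1%:R^-1 < r / 4.
    exists (Num.truncn (r / 4)^-1); rewrite invf_plt ?posrE ?divr_gt0//.
    exact: truncnS_gt.
  have e0 : 0 < n.+1%:R^-1 :> R by rewrite invr_gt0.
  have dr (y : R) : exists a, ball y (n.+1%:R^-1) (ratr a).
    suff : ball y (n.+1%:R^-1) `&` range ratr !=set0.
      by move=> [/= _ []] /[swap] -[a _ <-]; exists a.
    apply: dense_rat; last exact: ball_open.
    by exists y; exact: ballxx.
  have [a xa] := dr x.1; have [b xb] := dr x.2.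
  exists (a, b, n); last by split; exact/ball_sym.
  move=> z [za zb]; apply: (rU (r / 2)); rewrite /= ?sub0r ?normrN.
  - by rewrite gtr0_norm ?divr_gt0//; lra.
  - by rewrite divr_gt0.
  - have h : n.+1%:R^-1 + n.+1%:R^-1 <= r / 2.
      by move: nr; set t := _^-1 => nr; lra.
    split; apply: (le_ball h).
    + exact: (ball_triangle xa za).
    + exact: (ball_triangle xb zb).
rewrite bigcup_mkcond; apply: countable_bigcupT_measurable => [|c].
  exact: countableP.
case: ifP => _; last exact: measurable0.
rewrite ball_prodE; by apply: measurableX; apply: open_measurable; exact: ball_open.
Qed.

Lemma continuous_plane_measurable (U : set (R * R)) (f : R * R -> R) :
  open U -> (forall x, U x -> {for x, continuous f}) ->
  @measurable_fun _ _ plane (measurableTypeR R) U f.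
Proof.
move=> oU cf; apply: (measurability _ (RGenOpens.measurableE R)).
move=> _ [_ [a [b ->] <-]]; apply: open_plane_measurable.
rewrite openE => x [Ux fx]; apply: filterI; first exact: open_nbhs_nbhs.
apply: (cf x Ux); apply: open_nbhs_nbhs; split => //; exact: interval_open.
Qed.

Definition sqn (x : R * R) : R := x.1 ^+ 2 + x.2 ^+ 2.

Lemma continuous_sqn : continuous sqn.
Proof.
move=> x; rewrite /sqn /=; apply: cvgD; rewrite !expr2.
- by apply: cvgM; exact: cvg_fst.
- by apply: cvgM; exact: cvg_snd.
Qed.

Lemma sqn_ge0 x : 0 <= sqn x.
Proof. by rewrite addr_ge0// sqr_ge0. Qed.

Lemma OmegaP (x : R * R) : Omega x <-> sqn x < 1.
Proof.
rewrite /Omega /= /enorm -/(sqn x) -[X in _ < X]sqrtr1.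
by rewrite ltr_sqrt// ltr01.
Qed.

Lemma open_Omega : open (@Omega R).
Proof.
have -> : Omega = sqn @^-1` [set r | r < 1].
  by apply/seteqP; split => x /OmegaP.
by apply: open_comp; [move=> x _; exact: continuous_sqn|exact: open_lt].
Qed.

Lemma measurable_Omega : @measurable _ plane Omega.
Proof. by apply: open_plane_measurable; exact: open_Omega. Qed.

Lemma Omega_fst (x : R * R) : Omega x -> x.1 \in `[-1, 1].
Proof.
move=> /OmegaP; rewrite /sqn in_itv/= => h; rewrite -ler_norml.
rewrite -(@ler_pXn2r _ 2) ?nnegrE// real_normK ?num_real// expr1n.
by have := sqr_ge0 x.2; lra.
Qed.

Lemma Omega_snd (x : R * R) : Omega x -> x.2 \in `[-1, 1].
Proof.
move=> /OmegaP; rewrite /sqn in_itv/= => h; rewrite -ler_norml.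
rewrite -(@ler_pXn2r _ 2) ?nnegrE// real_normK ?num_real// expr1n.
by have := sqr_ge0 x.1; lra.
Qed.

Lemma leb2_Omega_lty : (@leb2 R Omega < +oo)%E.
Proof.
pose I : set R := `[-1, 1]%classic.
have mI : measurable I by exact: measurable_itv.
apply: (@le_lt_trans _ _ (leb2 (I `*` I))).
  apply: le_measure; rewrite ?inE; first exact: measurable_Omega.
    exact: measurableX.
  by move=> x Ox; split; [exact: Omega_fst|exact: Omega_snd].
have -> : leb2 (I `*` I) = (lebesgue_measure I * lebesgue_measure I)%E.
  exact: product_measure1E.
rewrite lebesgue_measure_itv/= lte_fin.
by rewrite ifT; [rewrite -EFinM ltry|lra].
Qed.

End Plane.

(** * Integrable functions on the disk and their bounded multipliers *)

Section IntegralOverDisk.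
Context {R : realType}.
Local Notation plane := (measurableTypeR R * measurableTypeR R)%type.
Local Notation leb2 := (@leb2 R).
Local Notation Omega := (@Omega R).
Implicit Types f g h k : R * R -> R.

Lemma ae_imply (P Q : R * R -> Prop) : (forall x, P x -> Q x) ->
  {ae leb2, forall x, P x} -> {ae leb2, forall x, Q x}.
Proof.
by move=> PQ; apply: negligibleS => x; apply: contra_not; exact: PQ.
Qed.

Lemma ae_imply2 (P Q S : R * R -> Prop) : (forall x, P x -> Q x -> S x) ->
  {ae leb2, forall x, P x} -> {ae leb2, forall x, Q x} ->
  {ae leb2, forall x, S x}.
Proof.
move=> PQS aP aQ; have := negligibleU aP aQ.
apply: negligibleS => x nS; apply: contrapT => /not_orP[/contrapT Px /contrapT Qx].
by apply: nS; exact: PQS.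
Qed.

Definition L1 h := leb2.-integrable Omega (EFin \o h).

(** The multipliers of [L1]: all coefficients that are integrated against [phi] or its weak
    derivatives belong to this class, which is stable under sums and products. *)
Definition bmeas k :=
  @measurable_fun _ _ plane (measurableTypeR R) Omega k /\
  exists C, forall x, Omega x -> `|k x| <= C.

Definition intO f : R := \int[leb2]_(x in Omega) f x.

Local Notation mO := (@measurable_Omega R).

Lemma bmeas_bounded k : bmeas k -> [bounded k x | x in Omega].
Proof.
move=> [_ [C kC]]; exists C; split; first exact: num_real.
by move=> y Cy x Ox; exact: le_trans (kC _ Ox) (ltW Cy).
Qed.

Lemma L1_meas h : L1 h -> @measurable_fun _ _ plane (measurableTypeR R) Omega h.
Proof. by move=> /integrableP[/measurable_EFinP]. Qed.

Let int_eq (F G : R * R -> \bar R) : (forall x, Omega x -> F x = G x) ->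
  leb2.-integrable Omega F -> leb2.-integrable Omega G.
Proof. by move=> FG; apply: eq_integrable; [exact: mO|move=> x /set_mem /FG]. Qed.

Lemma L1_emeas h : L1 h -> @measurable_fun _ _ plane _ Omega (EFin \o h).
Proof. exact: measurable_int. Qed.

Lemma L1M h k : L1 h -> bmeas k -> L1 (fun x => h x * k x).
Proof.
move=> h1 bk; have [mk _] := bk.
have := integrableMl mO h1 mk (bmeas_bounded bk).
by apply: int_eq => x _; rewrite /= EFinM.
Qed.

Lemma bmeas_L1 k : bmeas k -> L1 k.
Proof.
move=> bk; have [mk _] := bk.
apply: measurable_bounded_integrable => //; first exact: mO.
  exact: leb2_Omega_lty.
exact: bmeas_bounded.
Qed.

Lemma L1D h g : L1 h -> L1 g -> L1 (fun x => h x + g x).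
Proof.
move=> h1 g1; have := integrableD mO h1 g1.
by apply: int_eq => x _; rewrite /= EFinD.
Qed.

Lemma L1B h g : L1 h -> L1 g -> L1 (fun x => h x - g x).
Proof.
move=> h1 g1; have := integrableB mO h1 g1.
by apply: int_eq => x _; rewrite /= EFinB.
Qed.

Lemma L1Z c h : L1 h -> L1 (fun x => c * h x).
Proof.
move=> h1; have := integrableZl mO c h1.
by apply: int_eq => x _; rewrite /= EFinM.
Qed.

Lemma L1_eq h g : (forall x, Omega x -> h x = g x) -> L1 h -> L1 g.
Proof. by move=> hg; apply: int_eq => x Ox; rewrite /= hg. Qed.

Lemma bmeas_eq k g : (forall x, Omega x -> k x = g x) -> bmeas k -> bmeas g.
Proof.
move=> kg [mk [C kC]]; split.
  by apply: eq_measurable_fun mk => x /set_mem Ox; rewrite kg.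
by exists C => x Ox; rewrite -kg// kC.
Qed.

Lemma bmeas_cst c : bmeas (fun=> c).
Proof. by split; [exact: measurable_cst|exists `|c|]. Qed.

Lemma bmeasD k g : bmeas k -> bmeas g -> bmeas (fun x => k x + g x).
Proof.
move=> [mk [C kC]] [mg [D gD]]; split; first exact: measurable_funD.
by exists (C + D) => x Ox; rewrite (le_trans (ler_normD _ _))// lerD ?kC ?gD.
Qed.

Lemma bmeasM k g : bmeas k -> bmeas g -> bmeas (fun x => k x * g x).
Proof.
move=> [mk [C kC]] [mg [D gD]]; split; first exact: measurable_funM.
by exists (C * D) => x Ox; rewrite normrM ler_pM ?kC ?gD.
Qed.

Lemma bmeasB k g : bmeas k -> bmeas g -> bmeas (fun x => k x - g x).
Proof.
move=> bk bg; have := bmeasD bk (bmeasM (bmeas_cst (-1)) bg).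
by apply: bmeas_eq => x _; rewrite mulN1r.
Qed.

Lemma continuous_bmeas k C : (forall x, Omega x -> {for x, continuous k}) ->
  (forall x, Omega x -> `|k x| <= C) -> bmeas k.
Proof.
move=> ck kC; split; last by exists C.
exact: continuous_plane_measurable (@open_Omega R) ck.
Qed.

Lemma bmeas_sum (I : Type) (r : seq I) (P : pred I) (F : I -> R * R -> R) :
  (forall i, P i -> bmeas (F i)) -> bmeas (fun x => \sum_(i <- r | P i) F i x).
Proof.
move=> bF; elim: r => [|i r IH].
  by apply: bmeas_eq (bmeas_cst 0) => x _; rewrite big_nil.
case Pi: (P i); last by apply: bmeas_eq IH => x _; rewrite big_cons Pi.
apply: bmeas_eq (bmeasD (bF i Pi) IH) => x _.
by rewrite big_cons Pi.
Qed.

Lemma intO_EFin f : L1 f -> (intO f)%:E = (\int[leb2]_(x in Omega) (f x)%:E)%E.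
Proof.
by move=> f1; rewrite /intO /Rintegral fineK//; apply: integrable_fin_num => //; exact: mO.
Qed.

Lemma eq_intO f g : (forall x, Omega x -> f x = g x) -> intO f = intO g.
Proof. by move=> fg; apply: eq_Rintegral => x /set_mem; exact: fg. Qed.

Lemma intOD f g : L1 f -> L1 g -> intO (fun x => f x + g x) = intO f + intO g.
Proof. by move=> f1 g1; rewrite /intO -RintegralD//; exact: mO. Qed.

Lemma intOB f g : L1 f -> L1 g -> intO (fun x => f x - g x) = intO f - intO g.
Proof. by move=> f1 g1; rewrite /intO -RintegralB//; exact: mO. Qed.

Lemma intOZ c f : L1 f -> intO (fun x => c * f x) = c * intO f.
Proof. by move=> f1; rewrite /intO -RintegralZl//; exact: mO. Qed.

Lemma intO0 : intO (fun=> 0) = 0.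
Proof.
have z1 := bmeas_L1 (bmeas_cst 0).
rewrite -[RHS](mul0r (intO (fun=> 0))) -(intOZ 0 z1).
by apply: eq_intO => x _; rewrite mul0r.
Qed.

Lemma intO_sum (I : Type) (r : seq I) (F : I -> R * R -> R) :
  (forall i, L1 (F i)) -> intO (fun x => \sum_(i <- r) F i x) = \sum_(i <- r) intO (F i).
Proof.
move=> LF; have L r' : L1 (fun x => \sum_(i <- r') F i x).
  elim: r' => [|i r' IH].
    by apply: (L1_eq _ (bmeas_L1 (bmeas_cst 0))) => x _; rewrite big_nil.
  by apply: (L1_eq _ (L1D (LF i) IH)) => x _; rewrite big_cons.
elim: r => [|i r IH].
  by rewrite big_nil -[RHS]intO0; apply: eq_intO => x _; rewrite big_nil.
rewrite big_cons -IH -intOD//.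
by apply: eq_intO => x _; rewrite big_cons.
Qed.

Lemma le_intO f g : L1 f -> L1 g -> (forall x, Omega x -> f x <= g x) ->
  intO f <= intO g.
Proof. by move=> f1 g1 fg; apply: le_Rintegral => //; exact: mO. Qed.

Lemma le_norm_intO f : L1 f -> `|intO f| <= intO (fun x => `|f x|).
Proof. by move=> f1; apply: le_normr_Rintegral => //; exact: mO. Qed.

Lemma L1_norm f : L1 f -> L1 (fun x => `|f x|).
Proof. exact: integrable_norm. Qed.

Lemma intO_ae_eq f g : L1 f -> L1 g ->
  {ae leb2, forall x, Omega x -> f x = g x} -> intO f = intO g.
Proof.
move=> f1 g1 fg; rewrite /intO /Rintegral; congr fine.
apply: ae_eq_integral; [exact: mO|exact: L1_emeas..|].
by apply: ae_imply fg => x fg Ox; rewrite /= fg.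
Qed.

Lemma le_intO_ae f g : L1 f -> L1 g ->
  {ae leb2, forall x, Omega x -> f x <= g x} -> intO f <= intO g.
Proof.
move=> f1 g1 fg.
(* This is the maximum of [f] and [g]: it is above [f] everywhere and equal to [g] almost
   everywhere, which reduces the claim to the pointwise comparison. *)
pose M x := 2^-1 * (f x + g x + `|f x - g x|).
have M1 : L1 M by apply: L1Z; apply: L1D; [exact: L1D|apply: L1_norm; exact: L1B].
rewrite -(@intO_ae_eq M g)//.
  apply: le_intO => // x _; rewrite /M.
  by have := ler_norm (f x - g x); lra.
apply: ae_imply fg => x fg Ox; rewrite /M ler0_norm ?subr_le0 ?fg//; lra.
Qed.

Lemma intO_gt0 f : L1 f -> {ae leb2, forall x, Omega x -> 0 <= f x} ->
  ~ {ae leb2, forall x, Omega x -> f x = 0} -> 0 < intO f.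
Proof.
move=> f1 f0 nf; rewrite lt_neqAle; apply/andP; split; last first.
  have z1 := bmeas_L1 (bmeas_cst 0).
  have := le_intO_ae z1 f1 f0.
  by rewrite intO0.
apply/negP => /eqP i0; apply: nf.
have nn : intO (fun x => `|f x|) = 0.
  rewrite i0; apply: intO_ae_eq => //; first exact: L1_norm.
  by apply: ae_imply f0 => x f0 Ox; rewrite ger0_norm// f0.
have mf : @measurable_fun _ _ plane _ Omega (EFin \o f).
  exact: L1_emeas.
have := (ae_eq_integral_abs leb2 mO mf).1.
have -> : (\int[leb2]_(x in Omega) `|(EFin \o f) x| = 0)%E.
  by rewrite -[RHS]/(0%R%:E) -nn intO_EFin//; exact: L1_norm.
move=> /(_ erefl); apply: ae_imply => x + Ox => /(_ Ox) /=.
by case.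
Qed.

Lemma intO_bounded_cvg h (k_ : nat -> R * R -> R) g C : L1 h ->
  (forall n, bmeas (k_ n)) -> (forall n x, Omega x -> `|k_ n x| <= C) ->
  (forall x, Omega x -> h x * k_ n x @[n --> \oo] --> g x) ->
  L1 g /\ intO (fun x => h x * k_ n x) @[n --> \oo] --> intO g.
Proof.
move=> h1 bk_ kC kk.
have hk_ n := L1M h1 (bk_ n).
have mg : @measurable_fun _ _ plane (measurableTypeR R) Omega g.
  apply: (measurable_fun_cvg (h := fun n x => h x * k_ n x)); last exact: kk.
  by move=> n; exact: L1_meas (hk_ n).
have [] := @dominated_convergence _ plane R leb2 Omega mO
  (fun n => EFin \o (fun x => h x * k_ n x)) (EFin \o g)
  (EFin \o (fun x => C * `|h x|)).
- by move=> n; exact: L1_emeas (hk_ n).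
- exact/measurable_EFinP.
- apply: aeW => x Ox; apply/cvg_EFin; first by near=> n.
  exact: kk.
- by apply: L1Z; exact: L1_norm.
- apply: aeW => x n Ox; rewrite /= lee_fin normrM mulrC.
  by rewrite ler_wpM2r// kC.
move=> g1 _; rewrite -(intO_EFin g1) => /fine_cvgP[_] H.
by split => //; exact: cvg_trans H.
Unshelve. all: by end_near.
Qed.

Lemma indic_Omega_Lfun2 : (\1_Omega : R * R -> R) \in Lfun leb2 2%:E.
Proof.
rewrite inE; apply/andP; split; rewrite inE/=; first by apply: measurable_indic; exact: mO.
rewrite /finite_norm unlock; apply: poweR_lty.
apply: (@le_lt_trans _ _ (leb2 Omega)); last exact: leb2_Omega_lty.
have -> : (\int[leb2]_x `|(EFin \o \1_Omega) x| `^ 2 = \int[leb2]_x (\1_Omega x)%:E)%E.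
  apply: eq_integral => x _; rewrite /= indicE.
  by case: (x \in Omega); rewrite ?normr1 ?normr0 ?powR1// powR0// pnatr_eq0.
by rewrite integral_indic//; [rewrite setIT|exact: mO].
Qed.

Lemma L2_L1 f : L2 f -> L1 f.
Proof.
move=> f2; have := Lfun2_mul_Lfun1 f2 indic_Omega_Lfun2.
move/Lfun1_integrable => fi.
have : leb2.-integrable Omega (EFin \o ((f \_ Omega) \* \1_Omega)).
  by apply: integrableS fi => //; exact: mO.
apply: int_eq.
by move=> x /mem_set xO; rewrite /= patchE xO indicE xO mulr1.
Qed.

(** Hölder's inequality against the indicator of the disk, whose L^2 norm is [c0]: approximation in
    L^2 implies approximation in L^1, which is all that bounded multipliers require. *)
Lemma L2dist_intO f t e (c0 := fine 'N[leb2]_2%:E [EFin \o (\1_Omega : R * R -> R)]) :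
  L1 f -> L1 t -> (L2dist f t < e%:E)%E -> intO (fun x => `|f x - t x|) <= e * c0.
Proof.
move=> lf lt fte; have f1 := L1B lf lt.
have mf : @measurable_fun _ _ plane (measurableTypeR R) setT ((f \- t) \_ Omega).
  have m1 : @measurable_fun _ _ plane (measurableTypeR R) Omega (f \- t) := L1_meas f1.
  by apply/(measurable_restrictT (f \- t) mO).
have mi : @measurable_fun _ _ plane (measurableTypeR R) setT (\1_Omega).
  by apply: measurable_indic; exact: mO.
have c0f : ('N[leb2]_2%:E [EFin \o (\1_Omega : R * R -> R)])%E \is a fin_num.
  rewrite ge0_fin_numE ?Lnorm_ge0//.
  by have := indic_Omega_Lfun2; rewrite inE => /andP[_]; rewrite inE.
rewrite -lee_fin intO_EFin; last exact: L1_norm.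
rewrite EFinM /c0 fineK//.
apply: (@le_trans _ _ (L2dist f t *
  'N[leb2]_2%:E [EFin \o (\1_Omega : R * R -> R)])%E); last first.
  by rewrite lee_wpmul2r ?Lnorm_ge0// ltW.
have h22 : 2^-1 + 2^-1 = 1 :> R by rewrite [RHS]splitr !div1r.
have := @hoelder _ plane R leb2 ((f \- t) \_ Omega) (\1_Omega) 2 2 mf mi
  (ltr0n _ 2) (ltr0n _ 2) h22.
apply: le_trans.
rewrite Lnorm1 [leLHS]integral_mkcond le_eqVlt; apply/orP; left; apply/eqP.
apply: eq_integral => x _; rewrite /= !patchE indicE.
by case: (x \in Omega); rewrite ?mulr1 ?mulr0// normr0.
Qed.

End IntegralOverDisk.

(** * Smooth bumps *)

Section LineDerivatives.
Context {R : realType}.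
Implicit Types (f g : R * R -> R) (x : R * R).

Definition pcoord (i : bool) x : R := if i then x.2 else x.1.

Definition pline x (i : bool) (t : R) : R * R := if i then (x.1, t) else (t, x.2).

Lemma pline_pcoord x i : pline x i (pcoord i x) = x.
Proof. by case: i; case: x. Qed.

Lemma pcoord_pline x i t : pcoord i (pline x i t) = t.
Proof. by case: i. Qed.

(** Reduces partial derivatives to one real variable, where the chain rule and the fundamental
    theorem of calculus apply. *)
Lemma is_derive_line f x i d :
  is_derive (pcoord i x) 1 (fun t => f (pline x i t)) d <->
  is_derive x (edir i) f d.
Proof.
have E : (fun h : R => h^-1 *: (((fun t => f (pline x i t)) \o shift (pcoord i x)) (h *: 1)
            - f (pline x i (pcoord i x))))
       = (fun h => h^-1 *: ((f \o shift x) (h *: edir i) - f x)).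
  apply/funext => h /=; rewrite pline_pcoord; congr (_ *: (f _ - _)).
  by case: i; case: x => a b; rewrite /pline /edir /pcoord /=;
    congr (_, _); rewrite /= ?scaler0 ?add0r ?[_ *: 1]mulr1.
have D1 : derivable (fun t => f (pline x i t)) (pcoord i x) 1 = derivable f x (edir i).
  by rewrite /derivable E.
have D2 : 'D_1 (fun t => f (pline x i t)) (pcoord i x) = 'D_(edir i) f x.
  by rewrite /derive E.
by split=> -[dv vl]; apply: DeriveDef; rewrite ?D1 ?D2// -?D1 -?D2.
Qed.

Lemma is_derive_comp_dir f (F : R -> R) x i d D :
  is_derive x (edir i) f d -> is_derive (f x) 1 F D ->
  is_derive x (edir i) (F \o f) (D * d).
Proof.
move=> /is_derive_line df dF; apply/is_derive_line.
have : is_derive (f (pline x i (pcoord i x))) 1 F D by rewrite pline_pcoord.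
move=> {}dF.
exact: (is_derive1_comp dF df).
Qed.

(** For [k = 0] this is the classical flat function exp (-d / s), extended by 0. The powers of 1 / s
    are there because the derivative is then a combination of members of the same family. *)
Definition expbump (d : R) (k : nat) (s : R) : R :=
  if 0 < s then s^-1 ^+ k * expR (- (d / s)) else 0.

Lemma expbump_pos d k s : 0 < s -> expbump d k s = s^-1 ^+ k * expR (- (d / s)).
Proof. by rewrite /expbump => ->. Qed.

Lemma expbump_npos d k s : s <= 0 -> expbump d k s = 0.
Proof. by rewrite /expbump leNgt => /negbTE ->. Qed.

Lemma expRN_le (z : R) n : 0 < z -> expR (- z) <= n.+1`!%:R / z ^+ n.+1.
Proof.
move=> z0; rewrite expRN -[leRHS]invrK lef_pV2 ?posrE ?expR_gt0//; last first.
  by rewrite invr_gt0 divr_gt0// ?exprn_gt0// ltr0n fact_gt0.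
have := expR_ge1Dxn n (ltW z0); rewrite invf_div.
by apply: le_trans; rewrite lerDr.
Qed.

(** The bound [expRN_le] at z = d / s with exponent k + 2 absorbs the k negative powers of s and
    leaves s^2, so that the difference quotient at 0 tends to 0. *)
Lemma expbump_le d k s : 0 < d ->
  `|expbump d k s| <= k.+2`!%:R / d ^+ k.+2 * s ^+ 2.
Proof.
move=> d0; have C0 : 0 <= k.+2`!%:R / d ^+ k.+2 by rewrite divr_ge0// exprn_ge0// ltW.
have [s0|s0] := ltP 0 s; last by rewrite expbump_npos// normr0 mulr_ge0// sqr_ge0.
rewrite expbump_pos// ger0_norm; last first.
  by rewrite mulr_ge0// ?expR_ge0// exprn_ge0// invr_ge0 ltW.
have s0' : s != 0 by rewrite gt_eqF.
have d0' : d != 0 by rewrite gt_eqF.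
have -> : k.+2`!%:R / d ^+ k.+2 * s ^+ 2 = s^-1 ^+ k * (k.+2`!%:R / (d / s) ^+ k.+2).
  rewrite expr_div_n exprVn.
  have -> : s ^+ k.+2 = s ^+ k * s ^+ 2 by rewrite -exprD addn2.
  have := expf_neq0 k s0'; have := expf_neq0 k.+2 d0'.
  by move: (s ^+ k) (d ^+ k.+2) => X D D0 X0; field; rewrite s0' D0 X0.
apply: ler_wpM2l; first by rewrite exprn_ge0// invr_ge0 ltW.
by apply: expRN_le; rewrite divr_gt0.
Qed.

Lemma is_derive_expbump (d : R) k (s : R) : 0 < d ->
  is_derive s (1 : R) (expbump d k) (d * expbump d k.+2 s - k%:R * expbump d k.+1 s).
Proof.
move=> d0; have [s0|s0|s0] := ltgtP 0 s.
- rewrite !expbump_pos//.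
  have nz : s != 0 by rewrite gt_eqF.
   apply: (@near_eq_is_derive R R R (fun t => t^-1 ^+ k * expR (- (d / t)))).
    near=> t; rewrite expbump_pos//; near: t; exact: lt_nbhsr.
  have dV : is_derive s 1 (fun t : R => t^-1) (- s ^- 2).
    have := @is_deriveV R id s 1 1 nz (is_derive_id _ _).
    by move/is_derive_eq; apply; rewrite /GRing.scale /= mulr1.
  have dE : is_derive s 1 (fun t : R => expR (- (d / t))) (expR (- (d / s)) * (d / s ^+ 2)).
    apply: (is_derive1_comp (f := expR)).
    have -> : d / s ^+ 2 = (- d) *: (- s ^- 2) by rewrite /GRing.scale /= mulrNN.
    have := is_deriveZ (- d) dV.
    have -> : (- d) \*: (fun t : R => t^-1) = (fun t => - (d / t)).
      by apply/funext => t; exact: mulNr.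
    by [].
  have dX := @is_deriveX _ _ _ k _ _ _ dV.
  have := is_deriveM dX dE.
  have -> : (fun t : R => t^-1) ^+ k * (fun t : R => expR (- (d / t)))
     = (fun t => t^-1 ^+ k * expR (- (d / t))).
    by apply/funext => t; rewrite [LHS]/= fctE exprfctE.
  move/is_derive_eq; apply.
  (* For [k = 0] the predecessor is again 0, and the factor [k%:R] kills both sides. *)
  have K1 : k%:R * s^-1 ^+ k.-1 = k%:R * s^-1 ^+ k * s.
    case: (k) => [|m] /=; first by rewrite !mul0r.
    by rewrite [in RHS]exprS; field.
  rewrite /GRing.scale /= ?exprfctE K1 !exprS.
  by move: (s^-1 ^+ k) (expR _) => X Y; field.
- rewrite !expbump_npos ?(ltW s0)// !mulr0 subr0.
  apply: (@near_eq_is_derive R R R (cst 0)).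
  near=> t; rewrite expbump_npos// ltW//; near: t; exact: lt_nbhsl.
- rewrite -s0 !expbump_npos// !mulr0 subr0.
  suff H : (fun h : R => h^-1 *: ((expbump d k \o shift 0) (h *: 1) - expbump d k 0)) @ 0^' --> (0:R).
    by apply: DeriveDef; [apply/cvg_ex; exists 0|apply/cvg_lim].
  set C := k.+2`!%:R / d ^+ k.+2.
  apply: (@squeeze_cvgr _ _ _ _ (fun h => - (C * `|h|)) (fun h => C * `|h|)).
  + near=> h; rewrite -ler_norml /GRing.scale /= [h * 1]mulr1 addr0 (expbump_npos d k (lexx 0)) subr0.
    rewrite normrM normfV.
    have h0 : 0 < `|h| by rewrite normr_gt0; near: h; exact: nbhs_dnbhs_neq.
    rewrite mulrC ler_pdivrMr// -mulrA -expr2 real_normK ?num_real//.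
    exact: expbump_le.
  + have : C * `|h| @[h --> (0:R)] --> C * `|0 : R|.
      by apply: cvgM; [exact: cvg_cst|apply: cvg_norm; exact: cvg_id].
    rewrite normr0 mulr0 => /cvgN; rewrite oppr0 => H; exact: cvg_within_filter H.
  + have : C * `|h| @[h --> (0:R)] --> C * `|0 : R|.
      by apply: cvgM; [exact: cvg_cst|apply: cvg_norm; exact: cvg_id].
    rewrite normr0 mulr0 => H; exact: cvg_within_filter H.
Unshelve. all: by end_near.
Qed.

Lemma is_derive_sqn x i : is_derive x (edir i) sqn (2 * pcoord i x).
Proof.
apply/is_derive_line; case: i; rewrite /pline /pcoord /sqn /=.
- have := is_deriveD (is_derive_cst (x.1 ^+ 2) x.2 (1 : R)) (is_deriveX 2 (is_derive_id x.2 (1:R))).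
  move/is_derive_eq; apply; rewrite add0r /GRing.scale /= mulr1; ring.
- have := is_deriveD (is_deriveX 2 (is_derive_id x.1 (1:R))) (is_derive_cst (x.2 ^+ 2) x.1 (1 : R)).
  move/is_derive_eq; apply; rewrite addr0 /GRing.scale /= mulr1; ring.
Qed.

Lemma is_derive_pcoord x i j : is_derive x (edir i) (pcoord j) (i == j)%:R.
Proof.
apply/is_derive_line; case: i; case: j; rewrite /pline /pcoord /=.
- exact: is_derive_id.
- exact: (is_derive_cst x.1 x.2 (1 : R)).
- exact: (is_derive_cst x.2 x.1 (1 : R)).
- exact: is_derive_id.
Qed.

Lemma is_derive_expbump_sqn d k b x i : 0 < d ->
  is_derive x (edir i) (fun y => expbump d k (b - sqn y))
   ((d * expbump d k.+2 (b - sqn x) - k%:R * expbump d k.+1 (b - sqn x))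
     * (- 2 * pcoord i x)).
Proof.
move=> d0; apply: (@is_derive_comp_dir (fun y => b - sqn y) (expbump d k)).
  have := is_deriveB (is_derive_cst b x (edir i)) (is_derive_sqn x i).
  by move/is_derive_eq; apply; rewrite sub0r mulNr.
exact: is_derive_expbump.
Qed.

Lemma continuous_expbump d k : 0 < d -> continuous (expbump d k).
Proof.
move=> d0 s; apply/differentiable_continuous/derivable1_diffP.
by have [] := is_derive_expbump k s d0.
Qed.

(** A syntactic class closed under partial derivatives: derivatives of every order, as a test
    function must have, then come by induction on the list of directions. *)
Inductive smoothf : (R * R -> R) -> Prop :=
| smooth_cst c : smoothf (fun=> c)
| smooth_pcoord i : smoothf (pcoord i)
| smooth_expbump d k b of 0 < d : smoothf (fun x => expbump d k (b - sqn x))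
| smoothD f g of smoothf f & smoothf g : smoothf (fun x => f x + g x)
| smoothM f g of smoothf f & smoothf g : smoothf (fun x => f x * g x).

Lemma continuous_pcoord i : continuous (pcoord i).
Proof. by case: i => x; [exact: cvg_snd|exact: cvg_fst]. Qed.

Lemma smoothf_continuous f : smoothf f -> continuous f.
Proof.
elim=> [c|i|d k b d0|{}f g _ cf _ cg|{}f g _ cf _ cg] x.
- exact: cvg_cst.
- exact: continuous_pcoord.
- apply: (@continuous_comp _ _ _ (fun y => b - sqn y) (expbump d k)).
    by apply: cvgB; [exact: cvg_cst|exact: continuous_sqn].
  exact: continuous_expbump.
- by apply: cvgD; [exact: cf|exact: cg].
- by apply: cvgM; [exact: cf|exact: cg].
Qed.

Lemma smoothf_derive f i : smoothf f ->
  exists2 f', smoothf f' & forall x, is_derive x (edir i) f (f' x).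
Proof.
elim=> [c|j|d k b d0|{}f g sf [f' sf' df] sg [g' sg' dg]|{}f g sf [f' sf' df] sg [g' sg' dg]].
- by exists (fun=> 0); [exact: smooth_cst|move=> x; exact: is_derive_cst].
- exists (fun=> (i == j)%:R); first exact: smooth_cst.
  by move=> x; exact: is_derive_pcoord.
- exists (fun x => (d * expbump d k.+2 (b - sqn x) + - k%:R * expbump d k.+1 (b - sqn x))
     * (- 2 * pcoord i x)).
    by do ?[apply: smoothM|apply: smoothD|apply: smooth_cst|apply: smooth_pcoord|apply: smooth_expbump].
  by move=> x; rewrite mulNr; exact: is_derive_expbump_sqn.
- exists (fun x => f' x + g' x); first exact: smoothD.
  by move=> x; exact: is_deriveD.
- exists (fun x => f x * g' x + g x * f' x).
    by apply: smoothD; exact: smoothM.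
  by move=> x; exact: is_deriveM.
Qed.

Lemma pd1_is_derive f i f' : (forall x, is_derive x (edir i) f (f' x)) -> pd [:: i] f = f'.
Proof. by move=> df; apply/funext => x; rewrite /pd /=; exact: derive_val. Qed.

Lemma smoothf_pd s f : smoothf f -> smoothf (pd s f).
Proof.
move=> sf; elim: s => //= i s IH; have [f' sf' df] := smoothf_derive i IH.
by have /= -> := pd1_is_derive df.
Qed.

Lemma smoothf_test f K : smoothf f -> compact K -> K `<=` Omega ->
  (forall x, ~ K x -> f x = 0) -> test_function f.
Proof.
move=> sf cK KO fK; split; last by exists K.
move=> k; split => [s i x _ _|s x _ _]; last first.
  exact/smoothf_continuous/smoothf_pd.
by have [f' _ /(_ x)[]] := smoothf_derive i (smoothf_pd s sf).
Qed.

End LineDerivatives.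

(** * Green's formula *)

Section DivergenceIdentity.
Context {R : realType}.
Local Notation plane := (measurableTypeR R * measurableTypeR R)%type.
Implicit Types (x : R * R) (f X D t : R * R -> R) (K : set (R * R)).

Definition supported K f := forall x, ~ K x -> f x = 0.

Definition continuous_on f := forall x, Omega x -> {for x, continuous f}.

Lemma continuous_on_supported K f : compact K -> K `<=` Omega ->
  continuous_on f -> supported K f -> continuous f.
Proof.
move=> cK KO cf Kf x; have [Kx|nKx] := pselect (K x); first exact/cf/KO.
have clK : closed K by apply: compact_closed cK; exact: norm_hausdorff.
have oK : open (~` K) by exact: closed_openC.
have near0 : \forall y \near x, f y = 0.
  near=> y; rewrite Kf//; near: y; exact: open_nbhs_nbhs.
rewrite /prop_for /continuous_at (Kf _ nKx).
exact: cvg_near_cst.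
Unshelve. all: by end_near.
Qed.

Lemma supported_bounded K f : compact K -> continuous f -> supported K f ->
  exists C, forall x, `|f x| <= C.
Proof.
move=> cK cf Kf.
have : compact (f @` K) by apply: continuous_compact => //; exact: continuous_subspaceT.
move=> /compact_bounded[C [_ HC]].
exists (`|C| + 1) => x; have [Kx|nKx] := pselect (K x).
  by apply: HC; [rewrite ltr_pwDr// ler_norm|exists x].
by rewrite Kf// normr0 addr_ge0.
Qed.

Lemma supported_bmeas K f : compact K -> K `<=` Omega ->
  continuous_on f -> supported K f -> bmeas f.
Proof.
move=> cK KO cf Kf; have cf' := continuous_on_supported cK KO cf Kf.
have [C HC] := supported_bounded cK cf' Kf.
by apply: continuous_bmeas; [move=> x _; exact: cf'|move=> x _; exact: HC].
Qed.

Lemma integral_derivative_supported (q q' : R -> R) :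
  (forall s : R, is_derive s (1 : R) q (q' s)) -> continuous q' ->
  (forall s : R, s \notin `[-1, 1] -> q s = 0) -> (forall s : R, s \notin `[-1, 1] -> q' s = 0) ->
  (\int[lebesgue_measure]_s (q' s)%:E = 0)%E.
Proof.
(* The interval is wider than the support, so that [q] vanishes at both ends. *)
move=> dq cq' q0 q'0; pose I : interval R := `[-2, 2].
have -> : (\int[lebesgue_measure]_s (q' s)%:E =
           \int[lebesgue_measure]_(s in [set` I]) (q' s)%:E)%E.
  rewrite [RHS]integral_mkcond; apply: eq_integral => s _; rewrite patchE.
  case: ifPn => //; rewrite notin_setE /= => /negP ns; rewrite q'0//.
  by apply: contra ns; rewrite !in_itv/= => /andP[? ?]; apply/andP; split; lra.
have cq s : {for s, continuous q}.
  by apply/differentiable_continuous/derivable1_diffP; have [] := dq s.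
rewrite (@continuous_FTC2 _ q' q)//.
- by rewrite !q0 ?subee// in_itv/=; apply/negP => /andP[]; lra.
- by lra.
- exact: continuous_subspaceT.
- split; first by move=> s _; have [] := dq s.
  + by apply: cvg_at_right_filter; exact: cq.
  + by apply: cvg_at_left_filter; exact: cq.
- by move=> s _; rewrite derive1E; exact: derive_val.
Qed.

Lemma continuous_pline x i : continuous (pline x i).
Proof.
case: i => t; rewrite /pline.
- exact: (@cvg_pair _ _ _ (nbhs t) (nbhs x.1) (nbhs t) _ _ _ (fun=> x.1) id (cvg_cst _) cvg_id).
- exact: (@cvg_pair _ _ _ (nbhs t) (nbhs t) (nbhs x.2) _ _ _ id (fun=> x.2) cvg_id (cvg_cst _)).
Qed.

(** By Fubini, integrating first along direction [i]: on each line parallel to it, [D] is the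
    derivative of a compactly supported function. *)
Lemma intO_derivative_supported K i X D : compact K -> K `<=` Omega ->
  continuous D -> supported K X -> supported K D ->
  (forall x, is_derive x (edir i) X (D x)) -> intO D = 0.
Proof.
move=> cK KO cD KX KD dX.
have D1 : L1 D by apply: bmeas_L1; apply: (supported_bmeas cK KO) => // x _; exact: cD.
have DO : (EFin \o D) \_ Omega = EFin \o D.
  apply/funext => x; rewrite patchE; case: ifPn => //; rewrite notin_setE => nO.
  by rewrite /= KD// => /KO.
have iT : leb2.-integrable setT (EFin \o D).
  by rewrite -DO; apply/(integrable_mkcond _ (@measurable_Omega R)); exact: D1.
have line x : (\int[lebesgue_measure]_s (D (pline x i s))%:E = 0)%E.
  have nK s : s \notin `[-1, 1] -> ~ K (pline x i s).
    move=> /negP ns /KO Os; apply: ns; rewrite -(pcoord_pline x i s).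
    by case: (i) Os; [exact: Omega_snd|exact: Omega_fst].
  apply: (@integral_derivative_supported (fun s => X (pline x i s))).
  - move=> s; rewrite -{1}(pcoord_pline x i s).
    have := dX (pline x i s); move/is_derive_line.
    by case: (i).
  - move=> s; apply: (@continuous_comp _ _ _ (pline x i) D); first exact: continuous_pline.
    exact: cD.
  - by move=> s /nK; exact: KX.
  - by move=> s /nK; exact: KD.
apply: EFin_inj; rewrite intO_EFin// integral_mkcond DO.
case: i dX line => dX line.
- rewrite -[LHS](@integral12_prod_meas1 _ _ _ _ R lebesgue_measure lebesgue_measure)//.
  by apply: integral0_eq => a _; exact: (line (a, 0)).
- rewrite -[LHS](@integral21_prod_meas1 _ _ _ _ R lebesgue_measure lebesgue_measure)//.
  by apply: integral0_eq => a _; exact: (line (0, a)).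
Qed.

Lemma test_continuous t s : test_function t -> continuous (pd s t).
Proof. by move=> [ct _] x; have [_ /(_ s x)] := ct (size s); apply. Qed.

Lemma supported_pd K t s : closed K -> supported K t -> supported K (pd s t).
Proof.
move=> clK Kt; elim: s => //= i s IH x nKx.
have oK : open (~` K) by exact: closed_openC.
rewrite -(@derive_cst _ _ _ (0 : R) x (edir i)); apply: near_eq_derive.
near=> y; rewrite IH//; near: y; exact: open_nbhs_nbhs.
Unshelve. all: by end_near.
Qed.

Lemma test_bmeas t s : test_function t -> bmeas (pd s t).
Proof.
move=> tt; have [_ [K [cK KO Kt]]] := tt.
apply: (supported_bmeas cK KO); first by move=> x _; exact: test_continuous.
by apply: supported_pd => //; apply: compact_closed cK; exact: norm_hausdorff.
Qed.

Lemma test_pd t s : test_function t -> test_function (pd s t).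
Proof.
move=> [ct [K [cK KO Kt]]]; split; last first.
  exists K; split => //; apply: supported_pd => //.
  by apply: compact_closed cK; exact: norm_hausdorff.
move=> k; have [d c] := ct (k + size s)%N; split => [r i x rk _|r x rk _].
- by have := d (r ++ s) i x; rewrite /pd foldr_cat; apply => //; rewrite size_cat ltn_add2r.
- by have := c (r ++ s) x; rewrite /pd foldr_cat; apply => //; rewrite size_cat leq_add2r.
Qed.

Lemma test_is_derive t i x : test_function t -> is_derive x (edir i) t (pd [:: i] t x).
Proof.
move=> [ct _]; have [/(_ [::] i x) d _] := ct 1%N.
by apply: DeriveDef => //; exact: d.
Qed.

(** The product [t * X], which is 0 off a compact part of the disk, is differentiable on the whole
    plane even though [X] is controlled only inside the disk. *)
Lemma intO_test_div t i X D : test_function t ->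
  continuous_on X -> continuous_on D ->
  (forall x, Omega x -> is_derive x (edir i) X (D x)) ->
  intO (fun x => t x * D x) = - intO (fun x => pd [:: i] t x * X x).
Proof.
move=> tt cX cD dX; have [_ [K [cK KO Kt]]] := tt.
have clK : closed K by apply: compact_closed cK; exact: norm_hausdorff.
have Kt' : supported K (pd [:: i] t) by exact: supported_pd.
have KM f g : supported K f -> supported K (fun x => f x * g x).
  by move=> Kf x /Kf ->; rewrite mul0r.
have cM s f : continuous_on f -> continuous_on (fun x => pd s t x * f x).
  by move=> cf x Ox; apply: cvgM; [exact: test_continuous|exact: cf].
have b1 : bmeas (fun x => t x * D x).
  by apply: (supported_bmeas cK KO); [exact: (cM [::])|exact: KM].
have b2 : bmeas (fun x => pd [:: i] t x * X x).
  by apply: (supported_bmeas cK KO); [exact: cM|exact: KM].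
apply/eqP; rewrite -addr_eq0 -intOD; [|exact: bmeas_L1..]; apply/eqP.
apply: (@intO_derivative_supported K i (fun x => t x * X x)) => //.
- apply: (continuous_on_supported cK KO).
    by move=> x Ox; apply: cvgD; [exact: (cM [::])|exact: cM].
  by move=> x nK; rewrite Kt// Kt'// !mul0r addr0.
- exact: KM.
- by move=> x nK; rewrite Kt// Kt'// !mul0r addr0.
move=> x; have [Ox|nO] := pselect (Omega x).
  have := is_deriveM (test_is_derive i x tt) (dX x Ox).
  by move/is_derive_eq; apply; rewrite [X in _ + X = _]mulrC.
have nK : ~ K x by move=> /KO.
rewrite Kt// Kt'// !mul0r addr0.
have oK : open (~` K) by exact: closed_openC.
apply: (@near_eq_is_derive R _ R (cst 0)).
near=> y; rewrite Kt ?mul0r//; near: y; exact: open_nbhs_nbhs.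
Unshelve. all: by end_near.
Qed.

End DivergenceIdentity.

Section Green.
Context {R : realType}.
Implicit Types (x : R * R) (f X D t phi : R * R -> R).

(** Both sides depend continuously on [phi] and [G i] in L^1, because [X] and [D] are bounded. It is
    [phi] that vanishes on the circle in the sense of [H10], so [X] may be nonzero there and no
    boundary term appears. *)
Lemma H10_div phi (G : bool -> R * R -> R) i X D C :
  L2 phi -> L2 (G i) ->
  (forall e : R, 0 < e -> exists t, [/\ test_function t, (L2dist phi t < e%:E)%E &
     (L2dist (G i) (pd [:: i] t) < e%:E)%E]) ->
  continuous_on X -> continuous_on D ->
  (forall x, Omega x -> is_derive x (edir i) X (D x)) ->
  (forall x, Omega x -> `|X x| <= C) -> (forall x, Omega x -> `|D x| <= C) ->
  intO (fun x => phi x * D x) = - intO (fun x => G i x * X x).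
Proof.
move=> /L2_L1 p1 /L2_L1 g1 appr cX cD dX XC DC.
have bX := continuous_bmeas cX XC; have bD := continuous_bmeas cD DC.
set c0 := fine ('N[leb2]_2%:E [EFin \o (\1_Omega : R * R -> R)])%E.
have key e : 0 < e -> `|intO (fun x => phi x * D x) + intO (fun x => G i x * X x)| <= e * (c0 * C + c0 * C).
  move=> e0; have [t [tt pt gt]] := appr e e0.
  have t1 := bmeas_L1 (test_bmeas [::] tt); have t2 := bmeas_L1 (test_bmeas [:: i] tt).
  have est f g h : L1 f -> L1 g -> bmeas h -> (forall x, Omega x -> `|h x| <= C) ->
      (L2dist f g < e%:E)%E ->
      `|intO (fun x => f x * h x) - intO (fun x => g x * h x)| <= e * (c0 * C).
    move=> f1 g1' bh hC fg; have d1 := L1B f1 g1'.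
    rewrite -intOB; [|exact: L1M..].
    apply: (@le_trans _ _ (intO (fun x => C * `|f x - g x|))).
      apply: (le_trans (le_norm_intO (L1B (L1M f1 bh) (L1M g1' bh)))).
      apply: le_intO; [apply: L1_norm; apply: L1B; exact: L1M|apply: L1Z; exact: L1_norm|].
      by move=> x Ox; rewrite -mulrBl normrM mulrC ler_wpM2r// hC.
    rewrite intOZ; last exact: L1_norm.
    rewrite mulrA [leRHS]mulrC; apply: ler_wpM2l.
      by apply: le_trans (hC (0, 0) _) => //; apply/OmegaP; rewrite /sqn /= expr0n addr0.
    exact: L2dist_intO.
  have e1 := est _ _ _ p1 t1 bD DC pt; have e2 := est _ _ _ g1 t2 bX XC gt.
  have := intO_test_div tt cX cD dX.
  rewrite mulrDr => E; move: e1 e2; rewrite /= E => e1 e2.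
  apply: le_trans (lerD e1 e2); apply: le_trans (ler_normD _ _).
  by rewrite le_eqVlt; apply/orP; left; apply/eqP; congr `|_|; ring.
apply/eqP; rewrite -addr_eq0 -normr_eq0 eq_le normr_ge0 andbT.
apply/ler_addgt0Pl => e e0; rewrite addr0.
set c := c0 * C + c0 * C in key *.
apply: le_trans (key (e / (`|c| + 1)) _) _.
  by rewrite divr_gt0// ltr_pwDr.
rewrite mulrAC ler_pdivrMr ?ltr_pwDr// ler_wpM2l ?(ltW e0)//.
by rewrite (le_trans (ler_norm _))// lerDl.
Qed.

Lemma disk_compact (b : R) : b < 1 -> compact [set x : R * R | sqn x <= b] /\
  [set x : R * R | sqn x <= b] `<=` Omega.
Proof.
move=> b1; split; last by move=> x /= xb; apply/OmegaP; exact: le_lt_trans b1.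
have -> : [set x : R * R | sqn x <= b] =
    (`[-1, 1]%classic `*` `[-1, 1]%classic) `&` [set x | sqn x <= b].
  apply/seteqP; split => [x xb|x []//]; split => //.
  have Ox : Omega x by apply/OmegaP; exact: le_lt_trans b1.
  by split; [exact: Omega_fst|exact: Omega_snd].
apply: compact_closedI; first by apply: compact_setX; exact: segment_compact.
have -> : [set x : R * R | sqn x <= b] = sqn @^-1` [set r | r <= b] by [].
by apply: closed_comp; [move=> x _; exact: continuous_sqn|exact: closed_le].
Qed.

(** The function s exp (-d / s) for s > 0: a smooth substitute for max (s, 0), to which it tends as
    [d] tends to 0. *)
Definition bumpramp (d s : R) : R := s * expbump d 0 s.

Definition bumpramp' (d s : R) : R := expbump d 0 s + s * (d * expbump d 2 s).

Lemma smoothf_bumpramp d b : 0 < d -> smoothf (fun x => bumpramp d (b - sqn x)).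
Proof.
move=> d0; rewrite /bumpramp; apply: smoothM; last exact: smooth_expbump.
have -> : (fun x : R * R => b - sqn x) =
    (fun x => b + (-1) * (pcoord false x * pcoord false x + pcoord true x * pcoord true x)).
  by apply/funext => x; rewrite /sqn /pcoord mulN1r !expr2.
by do ?[apply: smoothD|apply: smoothM|apply: smooth_cst|apply: smooth_pcoord].
Qed.

Lemma test_bumpramp d b : 0 < d -> b < 1 -> test_function (fun x => bumpramp d (b - sqn x)).
Proof.
move=> d0 b1; have [cK KO] := disk_compact b1.
apply: (smoothf_test (smoothf_bumpramp b d0) cK KO) => x /= /negP; rewrite -ltNge => xb.
by rewrite /bumpramp expbump_npos ?mulr0//; lra.
Qed.

Lemma is_derive_bumpramp d s : 0 < d -> is_derive s (1 : R) (bumpramp d) (bumpramp' d s).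
Proof.
move=> d0; have := is_deriveM (is_derive_id s (1 : R)) (is_derive_expbump 0 s d0).
move/is_derive_eq; apply; rewrite mul0r subr0 /GRing.scale /= mulr1.
by rewrite addrC.
Qed.

Lemma pd_bumpramp d b i : 0 < d ->
  pd [:: i] (fun x => bumpramp d (b - sqn x)) = fun x => - (bumpramp' d (b - sqn x) * (2 * pcoord i x)).
Proof.
move=> d0; apply: pd1_is_derive => x.
have := is_deriveB (is_derive_cst b x (edir i)) (is_derive_sqn x i).
move=> /(@is_derive_comp_dir _ (fun y => b - sqn y) (bumpramp d)).
move=> /(_ _ (is_derive_bumpramp _ d0))/is_derive_eq; apply.
by rewrite sub0r mulrN.
Qed.

(** With z = d / s the derivative is (1 + z) exp (-z). The bound is uniform in [d], as dominated
    convergence requires. *)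
Lemma bumpramp'_bound d s : 0 < d -> `|bumpramp' d s| <= 2.
Proof.
move=> d0; rewrite /bumpramp'; have [s0|s0] := ltP 0 s; last first.
  by rewrite !expbump_npos// !mulr0 addr0 normr0.
rewrite !expbump_pos// expr0 mul1r.
have nz : s != 0 by rewrite gt_eqF.
have -> : s * (d * (s^-1 ^+ 2 * expR (- (d / s)))) = d / s * expR (- (d / s)) by field.
set z := d / s; have z0 : 0 < z by rewrite divr_gt0.
have h : expR (- z) * expR z = 1 by rewrite -expRD addNr expR0.
have := expR_gt0 (- z); have := expR_ge1Dx z; move: h.
set a := expR (- z); set c := expR z => h h1 a0.
have hz : 0 <= z * a by rewrite mulr_ge0 ?ltW.
have hm : a * (1 + z) <= a * c by rewrite ler_wpM2l// ltW.
by rewrite ger0_norm; lra.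
Qed.

Lemma continuous_bumpramp' d : 0 < d -> continuous (bumpramp' d).
Proof.
move=> d0 s; apply: cvgD; first exact: continuous_expbump.
apply: cvgM; first exact: cvg_id.
by apply: cvgM; [exact: cvg_cst|exact: continuous_expbump].
Qed.

Lemma cvg_harmonic0 : (n.+1%:R^-1 : R) @[n --> \oo] --> (0 : R).
Proof. exact: cvg_harmonic. Qed.

(** The argument is shifted by the same vanishing parameter so that, for s = 1 - |x|^2, the
    approximants still have compact support inside the disk. *)
Lemma bumpramp_cvg (s : R) :
  bumpramp n.+1%:R^-1 (s - n.+1%:R^-1) @[n --> \oo] --> Num.max s 0 /\
  bumpramp' n.+1%:R^-1 (s - n.+1%:R^-1) @[n --> \oo] --> (if 0 < s then 1 else 0 : R).
Proof.
have [s0|s0] := ltP 0 s; last first.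
  have E n : expbump n.+1%:R^-1 0 (s - n.+1%:R^-1) = 0 /\ expbump n.+1%:R^-1 2 (s - n.+1%:R^-1) = 0 :> R.
    have : 0 <= n.+1%:R^-1 :> R by rewrite invr_ge0.
    by move: (n.+1%:R^-1) => e e0; split; rewrite expbump_npos//; lra.
  split.
  - by under eq_fun do rewrite /bumpramp (E _).1 mulr0; exact: cvg_cst.
  - by under eq_fun do rewrite /bumpramp' (E _).1 (E _).2 !mulr0 addr0; exact: cvg_cst.
have cs : (s - n.+1%:R^-1) @[n --> \oo] --> s.
  by rewrite -[X in _ --> X]subr0; apply: cvgB; [exact: cvg_cst|exact: cvg_harmonic0].
have sn : \forall n \near \oo, 0 < s - n.+1%:R^-1.
  exact: (cvgr_gt s cs 0 s0).
have cV : (s - n.+1%:R^-1)^-1 @[n --> \oo] --> s^-1 by apply: cvgV => //; rewrite gt_eqF.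
have cz : (n.+1%:R^-1 / (s - n.+1%:R^-1)) @[n --> \oo] --> (0:R).
  by rewrite -(mul0r s^-1); apply: cvgM => //; exact: cvg_harmonic0.
have cE : expR (- (n.+1%:R^-1 / (s - n.+1%:R^-1))) @[n --> \oo] --> (1:R).
  have : expR (- (n.+1%:R^-1 / (s - n.+1%:R^-1))) @[n --> \oo] --> expR (- 0 : R).
    by apply: continuous_cvg; [exact: continuous_expR|exact: (cvgN cz)].
  by rewrite oppr0 expR0.
split.
- rewrite -[X in _ --> X]mulr1.
  have : (s - n.+1%:R^-1) * expR (- (n.+1%:R^-1 / (s - n.+1%:R^-1))) @[n --> \oo] --> s * 1 by exact: cvgM.
  apply: cvg_trans; apply: near_eq_cvg; near=> n.
  by rewrite /bumpramp expbump_pos ?expr0 ?mul1r//; near: n.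
- have : (1 + n.+1%:R^-1 / (s - n.+1%:R^-1)) * expR (- (n.+1%:R^-1 / (s - n.+1%:R^-1)))
      @[n --> \oo] --> (1 + 0) * (1 : R).
    by apply: cvgM => //; apply: cvgD => //; exact: cvg_cst.
  rewrite addr0 mulr1; apply: cvg_trans; apply: near_eq_cvg; near=> n.
  have p0 : 0 < s - n.+1%:R^-1 by near: n.
  rewrite /bumpramp' !expbump_pos// expr0 mul1r.
  move: (n.+1%:R^-1) p0 => d p0; have nz : s - d != 0 by rewrite gt_eqF.
  by move: (expR _) => E; field.
Unshelve. all: by end_near.
Qed.

End Green.

(** * Green's formula against ramps in the squared radius *)

Section GreenRadial.
Context {R : realType}.
Implicit Types (x : R * R) (phi : R * R -> R) (G g : bool -> R * R -> R).

(** What membership of [phi] in the domain of the operator provides, with the weak derivatives fixed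
    once and for all. *)
Definition green_data phi G g :=
  [/\ L2 phi, forall i, weak_pd [:: i] phi (G i),
      forall i, weak_pd [:: i; i] phi (g i) &
      forall e : R, 0 < e -> exists t, [/\ test_function t, (L2dist phi t < e%:E)%E &
        forall i, (L2dist (G i) (pd [:: i] t) < e%:E)%E]].

Variables (phi : R * R -> R) (G g : bool -> R * R -> R).
Hypothesis gd : green_data phi G g.

Let lapl x := g false x + g true x.

(** The inner product of the weak gradient of [phi] with the gradient of |x|^2. *)
Let flux x := G false x * (2 * pcoord false x) + G true x * (2 * pcoord true x).

Lemma green_data_L1 : [/\ L1 phi, forall i, L1 (G i) & forall i, L1 (g i)].
Proof.
by have [p2 wG wg _] := gd; split=> [|i|i]; apply: L2_L1 => //; [have [] := wG i|have [] := wg i].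
Qed.

Lemma L1_lapl : L1 lapl.
Proof. by have [_ _ g1] := green_data_L1; apply: L1D. Qed.

Lemma pcoord_bmeas i : bmeas (@pcoord R i).
Proof.
apply: (@continuous_bmeas _ _ 1) => [x _|x Ox]; first exact: continuous_pcoord.
by rewrite ler_norml; case: i; [have := Omega_snd Ox|have := Omega_fst Ox]; rewrite in_itv.
Qed.

Lemma L1_flux : L1 flux.
Proof.
have [_ G1 _] := green_data_L1.
by apply: L1D; apply: L1M => //; apply: bmeasM; [exact: bmeas_cst|exact: pcoord_bmeas| exact: bmeas_cst|exact: pcoord_bmeas].
Qed.

Lemma weak_second_test t i : test_function t ->
  intO (fun x => g i x * t x) = intO (fun x => phi x * pd [:: i; i] t x) /\
  intO (fun x => g i x * t x) = - intO (fun x => G i x * pd [:: i] t x).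
Proof.
move=> tt; have [_ wG wg _] := gd.
have [_ /(_ t tt)] := wg i; have [_ /(_ _ (test_pd [:: i] tt))] := wG i.
rewrite -!/(intO _) /= expr1 mulN1r sqrrN expr1n mul1r => E1 E2.
by split; [rewrite -E2|rewrite -E1 -E2].
Qed.

Lemma green_bumpramp d b : 0 < d -> b < 1 ->
  intO (fun x => lapl x * bumpramp d (b - sqn x)) =
  intO (fun x => flux x * bumpramp' d (b - sqn x)).
Proof.
move=> d0 b1; have tt := test_bumpramp d0 b1.
have [_ G1 g1] := green_data_L1.
have bt : bmeas (fun x => bumpramp d (b - sqn x)) := test_bmeas [::] tt.
have bt' i : bmeas (pd [:: i] (fun x => bumpramp d (b - sqn x))) := test_bmeas [:: i] tt.
transitivity (intO (fun x => g false x * bumpramp d (b - sqn x)) + intO (fun x => g true x * bumpramp d (b - sqn x))).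
  rewrite -intOD; [|exact: L1M..]; apply: eq_intO => x _; exact: mulrDl.
rewrite !(weak_second_test _ tt).2 -opprD -intOD; [|exact: L1M..].
rewrite -mulN1r -intOZ; last by apply: L1D; exact: L1M.
by apply: eq_intO => x _; rewrite !pd_bumpramp// /flux; ring.
Qed.

Lemma bmeas_ramp b : bmeas (fun x => Num.max (b - sqn x) 0).
Proof.
apply: (@continuous_bmeas _ _ (`|b| + 1)) => [x _|x /OmegaP Ox].
  apply: (@continuous_max _ _ (fun x => b - sqn x) (cst 0)); last exact: cvg_cst.
  by apply: cvgB; [exact: cvg_cst|exact: continuous_sqn].
have := sqn_ge0 x; have := ler_norm b; have := ler_norm (- b); rewrite normrN => h1 h2 h3.
by rewrite [X in X <= _]ger0_norm ?le_max ?lexx ?orbT// ge_max; apply/andP; split; lra.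
Qed.

Lemma bmeas_step b : bmeas (fun x => if 0 < b - sqn x then 1 else 0).
Proof.
split; last by exists 1 => x _; case: ifP => _; rewrite ?normr1 ?normr0.
have -> : (fun x : R * R => if 0 < b - sqn x then 1 else 0 : R) =
    \1_([set x | sqn x < b]).
  apply/funext => x; rewrite indicE subr_gt0; case: ifPn => h.
    by rewrite mem_set.
  by rewrite memNset//; exact/negP.
have oS : open [set x : R * R | sqn x < b].
  have -> : [set x : R * R | sqn x < b] = sqn @^-1` [set r | r < b] by [].
  by apply: open_comp; [move=> x _; exact: continuous_sqn|exact: open_lt].
by apply: measurable_indic; exact: open_plane_measurable oS.
Qed.

(** The case [b = 1] matters: that ramp reaches the circle and is not compactly supported, yet it is
    the limit of the shifted smooth ramps. *)
Lemma green_ramp b : b <= 1 ->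
  intO (fun x => lapl x * Num.max (b - sqn x) 0) =
  intO (fun x => flux x * (if 0 < b - sqn x then 1 else 0)).
Proof.
move=> b1; pose d n : R := n.+1%:R^-1.
have d0 n : 0 < d n by rewrite invr_gt0.
have bd n : b - d n < 1 by have := d0 n; lra.
have E n x : b - d n - sqn x = b - sqn x - d n by rewrite addrAC.
have b1_ n : bmeas (fun x => bumpramp (d n) (b - d n - sqn x)).
  exact: (test_bmeas [::] (test_bumpramp (d0 n) (bd n))).
have b2_ n : bmeas (fun x => bumpramp' (d n) (b - d n - sqn x)).
  apply: (@continuous_bmeas _ _ 2) => [x _|x _]; last exact: bumpramp'_bound.
  apply: (@continuous_comp _ _ _ (fun x => b - d n - sqn x)).
    by apply: cvgB; [exact: cvg_cst|exact: continuous_sqn].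
  exact: continuous_bumpramp'.
have C1 n x : Omega x -> `|bumpramp (d n) (b - d n - sqn x)| <= `|b| + 2.
  move=> /OmegaP Ox; rewrite /bumpramp; have [s0|s0] := ltP 0 (b - d n - sqn x); last first.
    by rewrite expbump_npos// mulr0 normr0 addr_ge0.
  rewrite expbump_pos// expr0 mul1r normrM [X in _ * X]ger0_norm ?expR_ge0//.
  rewrite -[leRHS]mulr1; apply: ler_pM; [by []|exact: expR_ge0| |].
    have := d0 n; have := ler_norm b; have := sqn_ge0 x; rewrite gtr0_norm//; lra.
  by rewrite -expR0 ler_expR oppr_le0 divr_ge0// ltW.
have H1 x : Omega x -> lapl x * bumpramp (d n) (b - d n - sqn x) @[n --> \oo] -->
    lapl x * Num.max (b - sqn x) 0.
  move=> _; apply: cvgM; first exact: cvg_cst.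
  by under eq_fun do rewrite E; exact: (bumpramp_cvg _).1.
have H2 x : Omega x -> flux x * bumpramp' (d n) (b - d n - sqn x) @[n --> \oo] -->
    flux x * (if 0 < b - sqn x then 1 else 0).
  move=> _; apply: cvgM; first exact: cvg_cst.
  by under eq_fun do rewrite E; exact: (bumpramp_cvg _).2.
have [_ L] := intO_bounded_cvg L1_lapl b1_ C1 H1.
have [_] := intO_bounded_cvg L1_flux b2_ (fun n x _ => bumpramp'_bound _ (d0 n)) H2.
rewrite -(_ : (fun n => intO (fun x => lapl x * bumpramp (d n) (b - d n - sqn x))) =
  (fun n => intO (fun x => flux x * bumpramp' (d n) (b - d n - sqn x)))).
  exact: cvg_unique L.
by apply/funext => n; exact: green_bumpramp.
Qed.

(* Integrates the interpolant of [N] at the nodes [k / m], a combination of ramps. *)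
Lemma green_interpolant (N : R -> R) m (s := fun k : nat => (m%:R : R) * (N (k.+1%:R / m%:R) - N (k%:R / m%:R)))
  (ramp := fun (k : nat) (r : R) => Num.max (k%:R / m%:R - r) 0)
  (step := fun (k : nat) (r : R) => if 0 < k%:R / m%:R - r then 1 else 0 : R) : (0 < m)%N ->
  intO (fun x => lapl x * (\sum_(k < m) s k * (ramp k (sqn x) - ramp k.+1 (sqn x)))) =
  - intO (fun x => flux x * (\sum_(k < m) s k * (step k.+1 (sqn x) - step k (sqn x)))).
Proof.
move=> m0.
have L1l k : L1 (fun x => lapl x * ramp k (sqn x)) by apply: L1M; [exact: L1_lapl|exact: bmeas_ramp].
have L1f k : L1 (fun x => flux x * step k (sqn x)) by apply: L1M; [exact: L1_flux|exact: bmeas_step].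
have gr k : (k <= m)%N -> intO (fun x => lapl x * ramp k (sqn x)) = intO (fun x => flux x * step k (sqn x)).
  by move=> km; apply: green_ramp; rewrite ler_pdivrMr ?ltr0n// mul1r ler_nat.
transitivity (\sum_(k < m) s k * (intO (fun x => lapl x * ramp k (sqn x)) - intO (fun x => lapl x * ramp k.+1 (sqn x)))).
  under eq_bigr => k _ do rewrite -(intOB (L1l _) (L1l _)) -(intOZ _ (L1B (L1l _) (L1l _))).
  rewrite -intO_sum; last by move=> k; apply: L1Z; exact: L1B.
  by apply: eq_intO => x _; rewrite mulr_sumr; apply: eq_bigr => k _; ring.
transitivity (- \sum_(k < m) s k * (intO (fun x => flux x * step k.+1 (sqn x)) - intO (fun x => flux x * step k (sqn x)))).
  rewrite -sumrN; apply: eq_bigr => k _; by rewrite -mulrN opprB !gr// ltnW.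
congr (- _).
under eq_bigr => k _ do rewrite -(intOB (L1f _) (L1f _)) -(intOZ _ (L1B (L1f _) (L1f _))).
rewrite -intO_sum; last by move=> k; apply: L1Z; exact: L1B.
by apply: eq_intO => x _; rewrite mulr_sumr; apply: eq_bigr => k _; ring.
Qed.

End GreenRadial.

(** * Piecewise linear interpolation in the squared radius *)

Section Interpolation.
Context {R : realType}.
Implicit Types (N : R -> R) (r : R).

(** When [r] lies in the cell of index [j], the terms before [j] vanish, the term [j] is the linear
    part, and the later ones telescope from N ((j + 1) / m) to N (m / m) = N 1. *)
Lemma ramp_sum N m j r (s := fun k : nat => m%:R * (N (k.+1%:R / m%:R) - N (k%:R / m%:R)))
  (ramp := fun (k : nat) (r : R) => Num.max (k%:R / m%:R - r) 0) :
  (0 < m)%N -> (j < m)%N -> j%:R / m%:R <= r -> r < j.+1%:R / m%:R ->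
  \sum_(k < m) s k * (ramp k r - ramp k.+1 r) =
  N (j.+1%:R / m%:R) - N 1 - s j * (j.+1%:R / m%:R - r).
Proof.
move=> m0 jm jr rj; have m0' : 0 < m%:R :> R by rewrite ltr0n.
have mN : m%:R != 0 :> R by rewrite gt_eqF.
have le k l : (k <= l)%N -> k%:R / m%:R <= l%:R / m%:R :> R.
  by move=> kl; rewrite ler_pM2r ?invr_gt0// ler_nat.
have r0 k : (k <= j)%N -> ramp k r = 0.
  by move=> /le kj; apply/max_idPr; rewrite subr_le0 (le_trans kj).
have r1 k : (j < k)%N -> ramp k r = k%:R / m%:R - r.
  by move=> /le kj; apply/max_idPl; rewrite subr_ge0 ltW// (lt_le_trans rj).
suff H l : (j.+1 + l <= m)%N -> \sum_(k < j.+1 + l) s k * (ramp k r - ramp k.+1 r) =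
    N (j.+1%:R / m%:R) - N ((j.+1 + l)%:R / m%:R) - s j * (j.+1%:R / m%:R - r).
  by have := H (m - j.+1)%N; rewrite subnKC// divff//; apply.
elim: l => [_|l IH lm].
  rewrite addn0 big_ord_recr /= big1 ?add0r; last first.
    by move=> k _; have kj := ltn_ord k; rewrite (r0 _ (ltnW kj)) (r0 _ kj) subrr mulr0.
  rewrite r0// r1//; ring.
rewrite addnS in lm *; rewrite big_ord_recr /= IH; last exact: ltnW.
have a1 : (j < j.+1 + l)%N by exact: leq_addr.
rewrite (r1 _ a1) (r1 _ (leqW a1)) /s.
move: (N _) (N _) (N _) (N _) => a b c d.
have -> : (j.+1 + l).+1%:R = (j.+1 + l)%:R + 1 :> R by rewrite natr1.
by field.
Qed.

Lemma step_sum m j r (s : nat -> R)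
  (step := fun (k : nat) (r : R) => if 0 < k%:R / m%:R - r then 1 else 0 : R) :
  (0 < m)%N -> (j < m)%N -> j%:R / m%:R <= r -> r < j.+1%:R / m%:R ->
  \sum_(k < m) s k * (step k.+1 r - step k r) = s j.
Proof.
move=> m0 jm jr rj; have m0' : 0 < m%:R :> R by rewrite ltr0n.
have le k l : (k <= l)%N -> k%:R / m%:R <= l%:R / m%:R :> R.
  by move=> kl; rewrite ler_pM2r ?invr_gt0// ler_nat.
have s0 k : (k <= j)%N -> step k r = 0.
  by move=> /le kj; rewrite /step subr_gt0 ltNge (le_trans kj).
have s1 k : (j < k)%N -> step k r = 1.
  by move=> /le kj; rewrite /step subr_gt0 (lt_le_trans rj).
rewrite (bigD1 (Ordinal jm)) //= s1// s0// subr0 mulr1 big1 ?addr0// => k kj.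
have [kj'|jk|e] := ltngtP k j.
- by rewrite !s0 ?subrr ?mulr0// ltnW.
- by rewrite !s1 ?subrr ?mulr0// ltnS ltnW.
- by move: kj; rewrite -val_eqE /= e eqxx.
Qed.

(** Only continuity is asked at 0 and 1, since a profile in the variable |x|^2 is differentiated
    only strictly between the centre and the circle. *)
Lemma MVT_open (N N' : R -> R) (a b : R) : (forall s : R, 0 < s < 1 -> is_derive s (1 : R) N (N' s)) ->
  {within `[0, 1], continuous N} -> 0 <= a -> a < b -> b <= 1 ->
  exists c, [/\ a < c, c < b & N b - N a = N' c * (b - a)].
Proof.
move=> dN cN a0 ab b1.
have sub : `[a, b] `<=` `[0, 1].
  by move=> s /=; rewrite !in_itv/= => /andP[? ?]; apply/andP; split; lra.
have [s|c] := @MVT R N N' a b ab _ (continuous_subspaceW sub cN).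
  by rewrite in_itv/= => /andP[? ?]; apply: dN; apply/andP; split; lra.
by rewrite in_itv/= => /andP[? ?] E; exists c.
Qed.

End Interpolation.

Section GreenRadialLimit.
Context {R : realType}.
Variables (phi : R * R -> R) (G g : bool -> R * R -> R).
Hypothesis gd : green_data phi G g.

Let lapl x := g false x + g true x.

Let flux x := G false x * (2 * pcoord false x) + G true x * (2 * pcoord true x).

(** On each cell the slope of the interpolant is a value of [N'], by the mean value theorem. Hence
    the interpolants are within 2 C / (n + 1) of [N], their slopes are bounded by [C] and tend to
    [N'], and dominated convergence applies on both sides. *)
Lemma green_radial (N N' : R -> R) (C : R) :
  (forall s : R, 0 < s < 1 -> is_derive s (1 : R) N (N' s)) ->
  {within `[0, 1], continuous N} -> N 1 = 0 ->
  (forall s : R, 0 < s < 1 -> `|N' s| <= C) ->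
  (forall s : R, 0 < s < 1 -> {for s, continuous N'}) ->
  intO (fun x => lapl x * N (sqn x)) = - intO (fun x => flux x * N' (sqn x)).
Proof.
move=> dN cN N1 N'C cN'.
pose q n : R := n.+1%:R.
pose s n (k : nat) : R := q n * (N (k.+1%:R / q n) - N (k%:R / q n)).
pose ramp n (k : nat) (r : R) := Num.max (k%:R / q n - r) 0.
pose step n (k : nat) (r : R) := if 0 < k%:R / q n - r then 1 else 0 : R.
pose I n r := \sum_(k < n.+1) s n k * (ramp n k r - ramp n k.+1 r).
pose I' n r := \sum_(k < n.+1) s n k * (step n k.+1 r - step n k r).
have q0 n : 0 < q n by rewrite ltr0n.
have C0 : 0 <= C by apply: le_trans (N'C (2^-1) _) => //; lra.
have lip a b : 0 <= a -> a <= b -> b <= 1 -> `|N b - N a| <= C * (b - a).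
  move=> a0; rewrite le_eqVlt => /predU1P[<- _|ab b1]; first by rewrite !subrr normr0 mulr0.
  have [c [ac cb ->]] := MVT_open dN cN a0 ab b1.
  by rewrite normrM [X in _ * X]ger0_norm ?subr_ge0 ?ler_wpM2r ?subr_ge0 ?(ltW ab)// N'C//; apply/andP; split; lra.
have node n r : 0 <= r < 1 -> exists j, [/\ (j < n.+1)%N, j%:R / q n <= r, r < j.+1%:R / q n &
    exists c, [/\ j%:R / q n < c, c < j.+1%:R / q n & s n j = N' c]].
  move=> /andP[r0 r1]; pose j := Num.truncn (q n * r).
  have /truncn_itv/andP[jl ju] : 0 <= q n * r by rewrite mulr_ge0// ltW.
  have jn : (j < n.+1)%N.
    rewrite -(@ltr_nat R); apply: le_lt_trans jl _; rewrite -/(q n).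
    by rewrite -[ltRHS]mulr1 ltr_pM2l.
  exists j; split => //; [by rewrite ler_pdivrMr// mulrC|by rewrite ltr_pdivlMr// mulrC|].
  have [|||c [c1 c2 E]] := MVT_open dN cN (a := j%:R / q n) (b := j.+1%:R / q n).
  - by rewrite divr_ge0// ltW.
  - by rewrite ltr_pM2r ?invr_gt0// ltr_nat.
  - by rewrite ler_pdivrMr// mul1r ler_nat.
  exists c; split => //; rewrite /s E -mulrBl -natr1 addrAC subrr add0r mul1r.
  by rewrite mulrCA divff ?mulr1// gt_eqF.
have in01 n j c : (j < n.+1)%N -> j%:R / q n < c -> c < j.+1%:R / q n -> 0 < c < 1.
  move=> jn c1 c2; apply/andP; split; first by apply: le_lt_trans c1; rewrite divr_ge0// ltW.
  by apply: lt_le_trans c2 _; rewrite ler_pdivrMr// mul1r ler_nat.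
have width n j : j.+1%:R / q n = j%:R / q n + (q n)^-1 by rewrite -natr1 mulrDl mul1r.
have I'C n r : 0 <= r < 1 -> `|I' n r| <= C.
  move=> /node-/(_ n)[j [jn jr rj [c [c1 c2 E]]]].
  by rewrite /I' (step_sum (s n) _ jn jr rj)// E N'C// (in01 n j).
have IN n r : 0 <= r < 1 -> `|I n r - N r| <= C * 2 * (q n)^-1.
  move=> rr; have [j [jn jr rj [c [c1 c2 E]]]] := node n r rr.
  rewrite /I (ramp_sum N _ jn jr rj)// N1 subr0 -/(s n j) E.
  have b1 : j.+1%:R / q n <= 1 by rewrite ler_pdivrMr// mul1r ler_nat.
  have /andP[r0 r1] := rr.
  have h1 := lip _ _ r0 (ltW rj) b1; have h2 := N'C c (in01 _ _ _ jn c1 c2).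
  have w : j.+1%:R / q n - r <= (q n)^-1 by rewrite width lerBlDr addrC lerD2l.
  have w0 : 0 <= j.+1%:R / q n - r by rewrite subr_ge0 ltW.
  rewrite addrAC; apply: le_trans (ler_normB _ _) _.
  have -> : C * 2 * (q n)^-1 = C * (q n)^-1 + C * (q n)^-1 by ring.
  apply: lerD; first by apply: le_trans h1 _; rewrite ler_wpM2l.
  by rewrite normrM [X in _ * X]ger0_norm// ler_pM.
have Or (x : R * R) : Omega x -> 0 <= sqn x < 1 by move=> /OmegaP h; rewrite sqn_ge0.
have bI n : bmeas (fun x : R * R => I n (sqn x)).
  apply: bmeas_sum => k _; apply: bmeasM; first exact: bmeas_cst.
  by apply: bmeasB; exact: bmeas_ramp.
have bI' n : bmeas (fun x : R * R => I' n (sqn x)).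
  apply: bmeas_sum => k _; apply: bmeasM; first exact: bmeas_cst.
  by apply: bmeasB; exact: bmeas_step.
have IB n (x : R * R) : Omega x -> `|I n (sqn x)| <= C * 3.
  move=> Ox; have /andP[r0 r1] := Or x Ox.
  have h := lip _ _ r0 (ltW r1) (lexx _); rewrite N1 sub0r normrN in h.
  have h2 := IN n _ (Or x Ox).
  have q1 : (q n)^-1 <= 1 by rewrite invf_le1// ler1n.
  have h3 := ler_normD (I n (sqn x) - N (sqn x)) (N (sqn x)); rewrite subrK in h3.
  have h4 : C * 2 * (q n)^-1 <= C * 2 * 1 by rewrite ler_wpM2l// mulr_ge0.
  have h5 : C * (1 - sqn x) <= C * 1 by rewrite ler_wpM2l//; lra.
  have h6 := le_trans h2 h4; clear h2 h4 q1; lra.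
have q00 : (q n)^-1 @[n --> \oo] --> (0 : R) by exact: cvg_harmonic0.
have LI x : Omega x -> lapl x * I n (sqn x) @[n --> \oo] --> lapl x * N (sqn x).
  move=> Ox; apply: cvgM; first exact: cvg_cst.
  apply/cvgrPdist_le => e e0.
  have : C * 2 * (q n)^-1 @[n --> \oo] --> C * 2 * 0 by apply: cvgM => //; exact: cvg_cst.
  rewrite mulr0 => /cvgrPdist_le/(_ e e0); apply: filterS => n; rewrite sub0r normrN => h.
  rewrite distrC; apply: le_trans (IN n _ (Or x Ox)) _; exact: le_trans (ler_norm _) h.
have LI' x : Omega x -> flux x * I' n (sqn x) @[n --> \oo] --> flux x * N' (sqn x).
  (* Nothing is known of [N'] at 0, but [flux] vanishes at the centre. *)
  move=> Ox; have [x0|x0] := eqVneq (sqn x) 0.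
    have -> : flux x = 0.
      move: x0; rewrite /flux /sqn /pcoord => /eqP.
      by rewrite paddr_eq0 ?sqr_ge0// !sqrf_eq0 => /andP[/eqP -> /eqP ->]; rewrite !mulr0 addr0.
    by under eq_fun do rewrite mul0r; rewrite mul0r; exact: cvg_cst.
  apply: cvgM; first exact: cvg_cst.
  have /andP[r0 r1] := Or x Ox; have rr : 0 < sqn x < 1 by rewrite lt_neqAle eq_sym x0 r0.
  apply/cvgrPdist_le => e e0.
  have := cN' _ rr; move/cvgrPdist_le/(_ e e0) => /nbhs_ballP[d /= d0 hd].
  have := q00; move/cvgrPdist_lt/(_ d d0); apply: filterS => n; rewrite sub0r normrN => h.
  have [j [jn jr rj [c [c1 c2 E]]]] := node n _ (Or x Ox).
  rewrite /I' (step_sum (s n) _ jn jr rj)// E; apply: hd; rewrite /ball/=.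
  apply: le_lt_trans h; rewrite [leRHS]ger0_norm ?invr_ge0 ?(ltW (q0 n))//.
  by rewrite ler_distl; move: c1 c2 jr rj; rewrite width; move: (j%:R / q n) ((q n)^-1) => A w *; apply/andP; split; lra.
have [_ L] := intO_bounded_cvg (L1_lapl gd) bI IB LI.
have [_ L'] := intO_bounded_cvg (L1_flux gd) bI' (fun n x Ox => I'C n _ (Or x Ox)) LI'.
apply: (cvg_unique _ L) => //.
rewrite (_ : (fun n => _) = (fun n => - intO (fun x => flux x * I' n (sqn x)))).
  exact: cvgN.
by apply/funext => n; exact: (green_interpolant gd N (ltn0Sn n)).
Qed.

End GreenRadialLimit.

(** * The radial equation *)

Section RadialODE.
Context {R : realType}.
Implicit Types (r s t : R).

(** Lets the starting point [e] of an integration tend to 0: the equation in the variable |x|^2 is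
    singular there, so estimates are first made from [e > 0]. *)
Lemma le_of_small (X Y K s : R) : 0 < s ->
  (forall e, 0 < e < s -> X <= Y + K * e) -> X <= Y.
Proof.
move=> s0 H; apply/ler_addgt0Pr => d d0.
pose e := Num.min (s / 2) (d / (`|K| + 1)).
have K0 : 0 < `|K| + 1 by rewrite ltr_pwDr.
have e0 : 0 < e by rewrite lt_min !divr_gt0.
have es : e < s by rewrite gt_min; apply/orP; left; lra.
have ed : e <= d / (`|K| + 1) by rewrite ge_min lexx orbT.
apply: le_trans (H e _) _; first by rewrite e0.
rewrite lerD2l; apply: (@le_trans _ _ ((`|K| + 1) * e)).
  by rewrite ler_wpM2r ?(ltW e0)// (le_trans (ler_norm _))// lerDl.
by rewrite mulrC -ler_pdivlMr.
Qed.

Lemma MVT_derive (f f' : R -> R) a b : a < b ->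
  (forall s, a <= s <= b -> is_derive s (1 : R) f (f' s)) ->
  exists c, [/\ a < c, c < b & f b - f a = f' c * (b - a)].
Proof.
move=> ab df; have [s||c] := @MVT R f f' a b ab.
- by rewrite in_itv/= => /andP[? ?]; apply: df; apply/andP; split; exact: ltW.
- apply: derivable_within_continuous => s; rewrite in_itv/= => sab.
  by have [] := df s sab.
by rewrite in_itv/= => /andP[? ?] E; exists c.
Qed.

(** At 0 the difference quotient is at most |h| in absolute value for small h, because q > 2. *)
Lemma is_derive_norm_powR q s : 2 < q ->
  is_derive s (1 : R) (fun t : R => `|t| `^ q) (q * (`|s| `^ (q - 2) * s)).
Proof.
move=> q2.
have E t : 0 < t -> t `^ (q - 1) = t `^ (q - 2) * t.
  move=> t0; rewrite mulrC -(@mulr_powRB1 _ t (q - 1)) ?(ltW t0)//; last by lra.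
  by congr (_ * _ `^ _); ring.
have [s0|s0|s0] := ltgtP 0 s.
- apply: (@near_eq_is_derive R R R (fun t => t `^ q)).
    near=> t; rewrite gtr0_norm//; near: t; exact: lt_nbhsr.
  have := is_derive1_powR q s0; move/is_derive_eq; apply.
  by rewrite E// gtr0_norm.
- apply: (@near_eq_is_derive R R R (fun t => (- t) `^ q)).
    near=> t; rewrite ltr0_norm//; near: t; exact: lt_nbhsl.
  have ns : 0 < - s by rewrite oppr_gt0.
  have := is_derive1_comp (is_derive1_powR q ns) (is_deriveN (is_derive_id s (1:R))).
  move/is_derive_eq; apply; rewrite E// ltr0_norm//; ring.
- rewrite -s0 mulr0 mulr0.
  suff H : (fun h : R => h^-1 *: (((fun t : R => `|t| `^ q) \o shift (0:R)) (h *: (1:R)) - (`|0 : R| `^ q : R))) @ 0^' --> (0:R).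
    by apply: DeriveDef; [apply/cvg_ex; exists 0|apply/cvg_lim].
  have n0 : `|h| @[h --> (0:R)] --> (0 : R) by rewrite -[X in _ --> X](normr0 R); apply: cvg_norm; exact: cvg_id.
  apply: (@squeeze_cvgr _ _ _ _ (fun h : R => - `|h|) (fun h : R => `|h|)).
  + near=> h; rewrite -ler_norml /GRing.scale /= [h * 1]mulr1 addr0 normr0 powR0 ?subr0; last by rewrite gt_eqF//; lra.
    rewrite normrM normfV [X in _ * X]ger0_norm ?powR_ge0//.
    have h0 : 0 < `|h| by rewrite normr_gt0; near: h; exact: nbhs_dnbhs_neq.
    have h1 : `|h| <= 1.
      near: h; apply: nbhs_dnbhs; move/cvgrPdist_le: n0 => /(_ 1 ltr01).
      by apply: filterS => h; rewrite sub0r normrN normr_id.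
    rewrite mulrC ler_pdivrMr// -expr2 -powR_mulrn//.
    by apply: ger_powR; [rewrite h0|exact: ltW].
  + by move/cvgN: n0; rewrite oppr0 => H; exact: cvg_within_filter H.
  + exact: cvg_within_filter n0.
Unshelve. all: by end_near.
Qed.

(** In the variable s = |x|^2 the Laplacian of a radial function N is 4 (s N')', so that P = s N'
    turns the equation into a first order system. The bounds [PC] and [NC0] express regularity at
    the centre, and [NC1] the boundary condition. *)
Variables (p u0 C : R) (N P : R -> R).
Hypothesis p3 : 3 <= p.
Hypothesis u0_gt0 : 0 < u0.
Hypothesis dN : forall s, 0 < s < 1 -> is_derive s (1 : R) N (P s / s).
Hypothesis dP : forall s, 0 < s < 1 -> is_derive s (1 : R) P (- (`|N s| `^ (p - 1) * N s) / 4).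
Hypothesis PC : forall s, 0 < s < 1 -> `|P s| <= C * s.
Hypothesis NC0 : forall s, 0 < s < 1 -> `|N s - u0| <= C * s.
Hypothesis NC1 : forall s, 0 < s < 1 -> `|N s| <= C * (1 - s).

Let A (v : R) := `|v| `^ (p + 1) / (p + 1).

Let p1_gt0 : 0 < p + 1. Proof. by have := p3; lra. Qed.

Let dA v : is_derive v (1 : R) A (`|v| `^ (p - 1) * v).
Proof.
have q2 : 2 < p + 1 by have := p3; lra.
have := is_deriveZ (p + 1)^-1 (is_derive_norm_powR v q2).
have -> : (p + 1)^-1 \*: (fun t => `|t| `^ (p + 1)) = A.
  by apply/funext => t; rewrite /A mulrC.
move/is_derive_eq; apply; rewrite /GRing.scale /= mulrA mulVf ?gt_eqF// mul1r.
by congr (_ `^ _ * _); ring.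
Qed.

Let A_ge0 v : 0 <= A v. Proof. by rewrite /A divr_ge0 ?powR_ge0// ltW. Qed.

(** The usual energy u_r^2 / 2 + |u|^(p+1) / (p + 1), since u_r = 2 P / r at s = r^2. *)
Let E s := 2 * P s ^+ 2 / s + A (N s).

Let dE s : 0 < s < 1 -> is_derive s (1 : R) E (- 2 * P s ^+ 2 / s ^+ 2).
Proof.
move=> s01; have /andP[s0 s1] := s01; have sn : s != 0 by rewrite gt_eqF.
have d1 := is_deriveX 2 (dP s01).
have d2 := is_deriveV sn (is_derive_id s (1:R)).
have d3 := is_deriveZ 2 (is_deriveM d1 d2).
have d4 := is_derive1_comp (dA (N s)) (dN s01).
have := is_deriveD d3 d4.
have -> : 2 \*: (P ^+ 2 * (fun y => (id y)^-1)) + (A \o N) = E.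
  apply/funext => t; rewrite /E -mulrA; congr (_ * (_ * _) + _).
move/is_derive_eq; apply; rewrite /GRing.scale /= ?exprfctE.
by move: (`|N s| `^ (p - 1)) (P s) (N s) => x y z; field.
Qed.

Lemma energy_le s t : 0 < t -> t <= s -> s < 1 ->
  2 * P s ^+ 2 / s + A (N s) <= 2 * P t ^+ 2 / t + A (N t).
Proof.
move=> t0; rewrite le_eqVlt => /predU1P[->//|ts] s1.
have [|c [c1 c2 e]] := @MVT_derive E (fun s => - 2 * P s ^+ 2 / s ^+ 2) t s ts.
  by move=> r /andP[r1 r2]; apply: dE; apply/andP; split; lra.
rewrite -/(E s) -/(E t) -subr_le0 e !mulNr oppr_le0 mulr_ge0 ?subr_ge0 ?(ltW ts)//.
by apply: divr_ge0; [apply: mulr_ge0 => //; exact: sqr_ge0|exact: sqr_ge0].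
Qed.

Let C_ge0 : 0 <= C.
Proof.
have h : 0 < (2^-1 : R) < 1 by apply/andP; split; lra.
by have := le_trans (normr_ge0 _) (PC h); rewrite pmulr_lge0// invr_gt0.
Qed.

(** At a small [t] the kinetic term is at most 2 C^2 t and [N t] is close to [u0], so the monotone
    energy is bounded by its value [A u0] at the centre; [A] increases with the absolute value. *)
Lemma radial_norm_le s : 0 < s < 1 -> `|N s| <= u0.
Proof.
move=> /andP[s0 s1].
have AN : A (N s) <= A u0.
  apply/ler_addgt0Pr => e e0.
  have cA : {for u0, continuous A}.
    by apply/differentiable_continuous/derivable1_diffP; have [] := dA u0.
  move/cvgrPdist_le: cA => /(_ (e / 2)); rewrite divr_gt0// => /(_ isT) /nbhs_ballP[d /= d0 hd].
  (* The second bound puts [N t] within [d] of [u0], the third makes the kinetic term at most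
     [e / 2]. *)
  pose t := Num.min s (Num.min (d / (2 * (C + 1))) (e / (4 * (C + 1) ^+ 2))).
  have C1 : 0 < C + 1 by have := C_ge0; lra.
  have t0 : 0 < t by rewrite !lt_min s0 !divr_gt0 ?mulr_gt0 ?exprn_gt0.
  have ts : t <= s by rewrite ge_min lexx.
  have td : t <= d / (2 * (C + 1)) by rewrite !ge_min lexx !orbT.
  have te : t <= e / (4 * (C + 1) ^+ 2) by rewrite !ge_min lexx !orbT.
  have t01 : 0 < t < 1 by rewrite t0 (le_lt_trans ts).
  have h1 := energy_le t0 ts s1.
  have h2 : A (N t) <= A u0 + e / 2.
    have : `|A u0 - A (N t)| <= e / 2.
      apply: hd; rewrite /ball/= distrC; apply: le_lt_trans (NC0 t01) _.
      move: td; rewrite ler_pdivlMr ?mulr_gt0// => td.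
      have : C * t <= (C + 1) * t by rewrite ler_wpM2r ?ltW//; lra.
      by move: td d0; nra.
    by rewrite ler_norml => /andP[]; lra.
  have h3 : 2 * P t ^+ 2 / t <= e / 2.
    rewrite ler_pdivrMr//.
    have h : P t ^+ 2 <= (C * t) ^+ 2.
      have -> : P t ^+ 2 = `|P t| ^+ 2 by rewrite real_normK ?num_real.
      apply: lerXn2r; rewrite ?nnegrE ?normr_ge0//; last exact: PC.
      by apply: mulr_ge0; [exact: C_ge0|exact: ltW].
    have hC : C ^+ 2 <= (C + 1) ^+ 2 by apply: lerXn2r; rewrite ?nnegrE ?(ltW C1) ?C_ge0// lerDl.
    move: te; rewrite ler_pdivlMr ?mulr_gt0 ?exprn_gt0// => te.
    have h4 : t * C ^+ 2 <= t * (C + 1) ^+ 2 by apply: ler_wpM2l => //; exact: ltW.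
    have h5 : t * (t * C ^+ 2) <= t * (e / 4) by apply: ler_wpM2l; [exact: ltW|lra].
    rewrite exprMn in h.
    have h6 : C ^+ 2 * t ^+ 2 = t * (t * C ^+ 2) by ring.
    by rewrite h6 in h; lra.
  have h4 : 0 <= 2 * P s ^+ 2 / s by apply: divr_ge0; [apply: mulr_ge0 => //; exact: sqr_ge0|exact: ltW].
  lra.
move: AN; rewrite /A ler_pM2r ?invr_gt0// (gtr0_norm u0_gt0) => AN.
rewrite leNgt; apply/negP => h; move: AN; rewrite leNgt => /negP; apply.
by apply: gt0_ltr_powR; rewrite ?nnegrE ?normr_ge0 ?(ltW u0_gt0)//.
Qed.

Let u0p : u0 `^ (p - 1) * u0 = u0 `^ p.
Proof. by rewrite mulrC mulr_powRB1 ?(ltW u0_gt0)//; have := p3; lra. Qed.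

Let aN_le s : 0 < s < 1 -> `| (`|N s| `^ (p - 1) * N s) | <= u0 `^ p.
Proof.
move=> s01; have h := radial_norm_le s01.
rewrite normrM (ger0_norm (powR_ge0 _ _)) -u0p ler_pM ?powR_ge0//.
by apply: ge0_ler_powR; rewrite ?nnegrE ?normr_ge0 ?(ltW u0_gt0)//; have := p3; lra.
Qed.

Lemma radial_slope_le s : 0 < s < 1 -> `|P s| <= u0 `^ p / 4 * s.
Proof.
move=> /andP[s0 s1]; apply: (@le_of_small _ _ C s) => // e /andP[e0 es].
have [r /andP[r1 r2]|c [c1 c2 h]] := @MVT_derive P (fun s => - (`|N s| `^ (p - 1) * N s) / 4) e s es.
  by apply: dP; apply/andP; split; lra.
have c01 : 0 < c < 1 by apply/andP; split; lra.
have e01 : 0 < e < 1 by apply/andP; split; lra.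
have := PC e01; have := ler_normD (P s - P e) (P e); rewrite subrK => h1 h2.
apply: le_trans h1 _; apply: lerD => //; rewrite h normrM.
have se : 0 < s - e by rewrite subr_gt0.
rewrite (gtr0_norm se); apply: ler_pM => //; [exact: ltW| |lra].
rewrite normrM normrN [X in _ * X]ger0_norm ?invr_ge0//.
by rewrite ler_wpM2r ?invr_ge0// aN_le.
Qed.

Lemma radial_ge s : 0 < s < 1 -> u0 - u0 `^ p / 4 * s <= N s.
Proof.
move=> /andP[s0 s1]; apply: (@le_of_small _ _ C s) => // e /andP[e0 es].
have [r /andP[r1 r2]|c [c1 c2 h]] := @MVT_derive N (fun s => P s / s) e s es.
  by apply: dN; apply/andP; split; lra.
have c01 : 0 < c < 1 by apply/andP; split; lra.
have e01 : 0 < e < 1 by apply/andP; split; lra.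
have c0 : 0 < c by lra.
have := NC0 e01; rewrite ler_norml => /andP[h1 _].
have hP : - (u0 `^ p / 4) <= P c / c.
  rewrite ler_pdivlMr// mulNr lerNl.
  by apply: le_trans (radial_slope_le c01); rewrite -normrN ler_norm.
have h2 : - (u0 `^ p / 4) * (s - e) <= P c / c * (s - e) by rewrite ler_wpM2r// subr_ge0 ltW.
have h3 : 0 <= u0 `^ p / 4 * e by rewrite mulr_ge0 ?divr_ge0 ?powR_ge0// ltW.
move: h h2; move: (P c / c * _) (u0 `^ p / 4) h3 => X Y h3 h h2; nra.
Qed.

(** The lower bound [radial_ge] holds up to the circle, where the profile vanishes: u0 - u0^p / 4
    cannot be positive. *)
Lemma radial_height : 4 <= u0 `^ (p - 1).
Proof.
suff h : u0 <= u0 `^ p / 4.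
  by move: h; rewrite -u0p mulrAC -[X in X <= _]mul1r ler_pM2r//; lra.
apply: (@le_of_small _ _ C 1) => // e /andP[e0 e1].
have e01 : 0 < 1 - e < 1 by apply/andP; split; lra.
have := NC1 e01; rewrite opprB addrCA subrr addr0 ler_norml => /andP[_ h1].
have h2 := radial_ge e01.
have h3 : u0 `^ p / 4 * (1 - e) <= u0 `^ p / 4 * 1.
  by rewrite ler_wpM2l ?divr_ge0 ?powR_ge0//; lra.
lra.
Qed.

Lemma radial_first_zero s : 0 < s < 1 -> N s < 0 ->
  exists t, [/\ 0 < t, t <= s, N t <= 0 & forall r, 0 < r < t -> 0 < N r].
Proof.
move=> /andP[s0 s1] Ns.
have Nge r : 0 < r < 1 -> u0 * (1 - u0 `^ (p - 1) / 4 * r) <= N r.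
  move=> /radial_ge; rewrite -u0p => h; apply: le_trans h.
  by rewrite le_eqVlt; apply/orP; left; apply/eqP; field.
(* Up to [d] the lower bound [Nge] is at least u0 / 2, so the first zero is sought in the compact
   interval from [d] to [s], away from the singular point. *)
pose d := 2 / u0 `^ (p - 1); have H4 := radial_height.
have w0 : 0 < u0 `^ (p - 1) by lra.
have d0 : 0 < d by rewrite divr_gt0.
have Npos r : 0 < r -> r <= d -> r < 1 -> 0 < N r.
  move=> r0 rd r1; have r01 : 0 < r < 1 by rewrite r0.
  apply: lt_le_trans (Nge r r01); rewrite mulr_gt0// subr_gt0.
  by move: rd; rewrite /d ler_pdivlMr// => rd; lra.
have ds : d <= s.
  by rewrite leNgt; apply/negP => sd; have := lt_trans Ns (Npos s s0 (ltW sd) s1); rewrite ltxx.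
clearbody d.
pose Z := `[d, s] `&` [set t | N t <= 0].
have cZ : closed Z.
  move=> x clx.
  have xI : `[d, s]%classic x.
    have cI : closed (`[d, s]%classic : set R) by exact: interval_closed.
    by apply: cI; apply: closure_subset clx => y [].
  split => //=; rewrite leNgt; apply/negP => Nx.
  move: xI; rewrite /= in_itv/= => /andP[dx xs].
  have x01 : 0 < x < 1 by rewrite (lt_le_trans d0 dx) (le_lt_trans xs s1).
  have cx : {for x, continuous N}.
    by apply/differentiable_continuous/derivable1_diffP; have [] := dN x01.
  have : \forall y \near x, 0 < N y by exact: (cvgr_gt _ cx 0 Nx).
  by move=> /clx[y [[_ /= h1] h2]]; have := le_lt_trans h1 h2; rewrite ltxx.
have kZ : compact Z.
  have -> : Z = `[d, s]%classic `&` Z by rewrite /Z setIA setIid.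
  by apply: compact_closedI => //; exact: segment_compact.
have nZ : Z !=set0 by exists s; split; rewrite /= ?in_itv/= ?ds ?lexx// ltW.
have [t] := compact_EVT_min nZ kZ (continuous_subspaceT (fun x => @cvg_id _ (nbhs x))).
rewrite inE /Z /= in_itv/= => -[/andP[dt ts] Nt] tmin.
exists t; split => //; first by lra.
move=> r /andP[r0 rt]; rewrite ltNge; apply/negP => Nr.
have [rd|dr] := leP r d.
  have r1 : r < 1 by lra.
  by have := le_lt_trans Nr (Npos r r0 rd r1); rewrite ltxx.
suff tr : t <= r by have := lt_le_trans rt tr; rewrite ltxx.
by apply: tmin; rewrite inE; split => //=; rewrite in_itv/=; apply/andP; split; lra.
Qed.

Let NaN v : 0 < v -> A v = `|v| `^ (p - 1) * v * v / (p + 1).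
Proof.
move=> v0; rewrite /A gtr0_norm//; congr (_ / _).
have -> : p + 1 = (p - 1) + 2 by ring.
rewrite powRD; last by rewrite (gt_eqF v0) implybT.
by rewrite (powR_mulrn 2 (ltW v0)) expr2 mulrA.
Qed.

Let A_mono v w : `|v| <= `|w| -> A v <= A w.
Proof.
move=> vw; rewrite /A ler_pM2r ?invr_gt0//.
by apply: ge0_ler_powR; rewrite ?nnegrE ?normr_ge0// ltW.
Qed.

(* The Pohozaev functional is nonincreasing until the first zero of [N]. *)
Lemma pohozaev_le0 t : 0 < t < 1 -> (forall r, 0 < r < t -> 0 < N r) ->
  2 * P t ^+ 2 + t * A (N t) + 4 * u0 / (p + 1) * P t <= 0.
Proof.
move=> /andP[t0 t1] Npos; set k := 4 * u0 / (p + 1).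
have k0 : 0 < k by rewrite divr_gt0// mulr_gt0.
pose F r := 2 * P r ^+ 2 + r * A (N r) + k * P r.
(* The products of [P] with the nonlinearity cancel. With this [k], the derivative is |N|^(p-1) N (N
   - u0) / (p + 1) where [N] is positive, and [N <= u0]. *)
have dF r : 0 < r < 1 -> is_derive r (1 : R) F (A (N r) - u0 / (p + 1) * (`|N r| `^ (p - 1) * N r)).
  move=> r01; have /andP[r0 r1] := r01.
  have d1 := is_deriveZ 2 (is_deriveX 2 (dP r01)).
  have d2 := is_deriveM (is_derive_id r (1:R)) (is_derive1_comp (dA (N r)) (dN r01)).
  have d3 := is_deriveZ k (dP r01).
  have := is_deriveD (is_deriveD d1 d2) d3.
  move/is_derive_eq; apply; rewrite /GRing.scale /= /k.
  move: (`|N r| `^ (p - 1)) (P r) (N r) (A (N r)) => x y z w.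
  by field; rewrite !gt_eqF.
rewrite -/(F t); apply: (@le_of_small _ _ (2 * C ^+ 2 + A u0 + k * C) t) => // e /andP[e0 et].
have [r /andP[r1 r2]|c [c1 c2 h]] := @MVT_derive F
    (fun r => A (N r) - u0 / (p + 1) * (`|N r| `^ (p - 1) * N r)) e t et.
  by apply: dF; apply/andP; split; lra.
have c0 : 0 < c by lra.
have c01 : 0 < c < 1 by apply/andP; split; lra.
have e01 : 0 < e < 1 by apply/andP; split; lra.
have Nc : 0 < N c by apply: Npos; rewrite c0.
have Fd : F t <= F e.
  rewrite -subr_le0 h; apply: mulr_le0_ge0; last by rewrite subr_ge0 ltW.
  rewrite NaN// -mulrA mulrC -[X in _ - X]mulrA.
  have -> : N c / (p + 1) * (`|N c| `^ (p - 1) * N c) - u0 * ((p + 1)^-1 * (`|N c| `^ (p - 1) * N c))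
     = (N c - u0) * ((p + 1)^-1 * (`|N c| `^ (p - 1) * N c)) by ring.
  apply: mulr_le0_ge0; last by rewrite !mulr_ge0 ?powR_ge0 ?invr_ge0// ltW.
  by rewrite subr_le0 (le_trans (ler_norm _)) ?radial_norm_le.
apply: le_trans Fd _; rewrite add0r /F.
have hP : P e ^+ 2 <= C ^+ 2 * e.
  have -> : P e ^+ 2 = `|P e| ^+ 2 by rewrite real_normK ?num_real.
  apply: (@le_trans _ _ ((C * e) ^+ 2)).
    apply: lerXn2r; rewrite ?nnegrE ?normr_ge0//; last exact: PC.
    by apply: mulr_ge0; [exact: C_ge0|exact: ltW].
  rewrite exprMn ler_wpM2l ?sqr_ge0// expr2 -[leRHS]mulr1 ler_wpM2l ?(ltW e0)//; lra.
have hA : e * A (N e) <= e * A u0.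
  by rewrite ler_wpM2l ?(ltW e0)// A_mono// (gtr0_norm u0_gt0) radial_norm_le.
have hk : k * P e <= k * (C * e).
  by rewrite ler_wpM2l ?(ltW k0)// (le_trans (ler_norm _)) ?PC.
lra.
Qed.

(** At the first zero [t], the Pohozaev inequality confines [P t] between -k / 2 and 0, so the
    energy there is at most k^2 / (2 t). The bound [radial_ge] at [t] gives t u0^(p-1) >= 4, and the
    energy decreases from [t] to [s]; inserting k = 4 u0 / (p + 1) yields the constant. *)
Lemma radial_negative_bound s : 0 < s < 1 -> N s < 0 ->
  `|N s| `^ (p + 1) <= 2 / (p + 1) * u0 `^ (p + 1).
Proof.
move=> s01 Ns; have [t [t0 ts Nt Npos]] := radial_first_zero s01 Ns.
have /andP[s0 s1] := s01; have t1 : t < 1 by lra.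
have t01 : 0 < t < 1 by rewrite t0.
have := pohozaev_le0 t01 Npos; set k := 4 * u0 / (p + 1) => poh.
have k0 : 0 < k by rewrite divr_gt0// mulr_gt0.
have en := energy_le t0 ts s1.
have hs : 0 <= 2 * P s ^+ 2 / s.
  by apply: divr_ge0; [apply: mulr_ge0 => //; exact: sqr_ge0|exact: ltW].
have w4 : 4 <= u0 `^ (p - 1) * t.
  have := radial_ge t01; rewrite -u0p => h.
  rewrite -(ler_pM2l u0_gt0); lra.
have tA : 0 <= t * A (N t) by rewrite mulr_ge0// ltW.
have hP : 2 * P t ^+ 2 + t * A (N t) <= k ^+ 2 / 2.
  have h1 : P t <= 0 by rewrite leNgt; apply/negP => h; have h1 := sqr_ge0 (P t); have h2 : 0 < k * P t by [exact: mulr_gt0]; move: poh; rewrite leNgt => /negP; apply; lra.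
  have h2 : - k / 2 <= P t.
    rewrite leNgt; apply/negP => h.
    have h2 : 0 < P t * (2 * P t + k) by rewrite nmulr_rgt0; lra.
    by move: poh; rewrite leNgt => /negP; apply; lra.
  have : k * (- k / 2) <= k * P t by rewrite ler_wpM2l// ltW.
  lra.
have hA : A (N s) * t <= k ^+ 2 / 2.
  apply: le_trans hP.
  have -> : 2 * P t ^+ 2 + t * A (N t) = (2 * P t ^+ 2 / t + A (N t)) * t.
    by field; rewrite gt_eqF.
  apply: ler_wpM2r; first exact: ltW.
  by apply: le_trans en; rewrite lerDr.
have hA2 : A (N s) <= k ^+ 2 / 8 * u0 `^ (p - 1).
  rewrite -(ler_pM2r t0); apply: le_trans hA _; rewrite -mulrA.
  have : k ^+ 2 / 8 * 4 <= k ^+ 2 / 8 * (u0 `^ (p - 1) * t).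
    by rewrite ler_wpM2l// divr_ge0 ?sqr_ge0.
  lra.
move: hA2; rewrite /A ler_pdivrMr//; move/le_trans; apply.
have -> : u0 `^ (p + 1) = u0 `^ (p - 1) * u0 ^+ 2.
  have -> : p + 1 = (p - 1) + 2 by ring.
  rewrite powRD; last by rewrite (gt_eqF u0_gt0) implybT.
  by rewrite (powR_mulrn 2 (ltW u0_gt0)).
rewrite le_eqVlt; apply/orP; left; apply/eqP; rewrite /k.
by field; rewrite gt_eqF.
Qed.

End RadialODE.

Section GreenIdentity.
Context {R : realType}.
Variables (phi : R * R -> R) (G g : bool -> R * R -> R).
Hypothesis gd : green_data phi G g.

(** The two halves of Green's formula for T (x) = N (|x|^2) meet at the integral of grad phi . grad
    T. The derivatives of T enter as the fields [X] and [D] on the disk, so that [N] itself need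
    only be continuous at 0. *)
Lemma green_identity (N N' : R -> R) (X D : bool -> R * R -> R) (C : R) :
  (forall s : R, 0 < s < 1 -> is_derive s (1 : R) N (N' s)) ->
  {within `[0, 1], continuous N} -> N 1 = 0 ->
  (forall s : R, 0 < s < 1 -> `|N' s| <= C) ->
  (forall s : R, 0 < s < 1 -> {for s, continuous N'}) ->
  (forall i, continuous_on (X i)) -> (forall i, continuous_on (D i)) ->
  (forall i x, Omega x -> is_derive x (edir i) (X i) (D i x)) ->
  (forall i x, Omega x -> `|X i x| <= C) -> (forall i x, Omega x -> `|D i x| <= C) ->
  (forall i x, Omega x -> X i x = 2 * pcoord i x * N' (sqn x)) ->
  intO (fun x => phi x * (D false x + D true x)) = intO (fun x => (g false x + g true x) * N (sqn x)).
Proof.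
move=> dN cN N1 N'C cN' cX cD dX XC DC XE.
have [p1 G1 g1] := green_data_L1 gd; have [p2 wG _ appr] := gd.
have bX i := continuous_bmeas (cX i) (XC i); have bD i := continuous_bmeas (cD i) (DC i).
have div i : intO (fun x => phi x * D i x) = - intO (fun x => G i x * X i x).
  have [Gi2 _] := wG i; apply: (H10_div p2 Gi2 _ (cX i) (cD i) (dX i) (XC i) (DC i)).
  by move=> e /appr[t [tt pt Gt]]; exists t.
transitivity (intO (fun x => phi x * D false x) + intO (fun x => phi x * D true x)).
  by rewrite -intOD; [apply: eq_intO => x _; exact: mulrDr|exact: L1M|exact: L1M].
rewrite !div -opprD -intOD; [|exact: L1M|exact: L1M].
rewrite (green_radial gd dN cN N1 N'C cN'); congr (- _).
by apply: eq_intO => x Ox; rewrite !XE//; ring.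
Qed.

End GreenIdentity.

(** * The closed disk and bounds for functions of class C^2 up to the boundary *)

Section DiskClosure.
Context {R : realType}.

Lemma closure_Omega_bound (x : R * R) : closure Omega x -> sqn x <= 1.
Proof.
have cD : closed [set x : R * R | sqn x <= 1].
  have -> : [set x : R * R | sqn x <= 1] = sqn @^-1` [set r | r <= 1] by [].
  by apply: closed_comp; [move=> y _; exact: continuous_sqn|exact: closed_le].
move=> /(closure_subset (B := [set x : R * R | sqn x <= 1])) h; apply: (cD x); apply: h.
by move=> y /OmegaP /ltW.
Qed.

Lemma closure_Omega_e1 : closure (@Omega R) (1, 0).
Proof.
move=> B B1; have /= cB := @continuous_pline R (0, 0) false 1.
have /nbhs_ballP[d /= d0 hd] := cB B B1.
pose t : R := 1 - Num.min (d / 2) (2^-1).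
have m0 : 0 < Num.min (d / 2) (2^-1) by rewrite lt_min divr_gt0//=; lra.
have m1 : Num.min (d / 2) (2^-1) <= 2^-1 by rewrite ge_min lexx orbT.
have m2 : Num.min (d / 2) (2^-1) <= d / 2 by rewrite ge_min lexx.
exists (t, 0); split.
  apply/OmegaP; rewrite /sqn /= expr0n addr0 expr_lt1//; rewrite /t; lra.
by apply: hd; rewrite /ball/= /t opprB addrCA subrr addr0 gtr0_norm//; lra.
Qed.

Lemma compact_closure_Omega : compact (closure (@Omega R)).
Proof.
have -> : closure (@Omega R) = (`[-1, 1]%classic `*` `[-1, 1]%classic) `&` closure Omega.
  apply/seteqP; split => [x clx|x []//]; split => //.
  have := closure_Omega_bound clx; rewrite /sqn => h.
  by split; rewrite /= in_itv/= -ler_norml -(@ler_pXn2r _ 2) ?nnegrE// real_normK ?num_real// expr1n;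
   [have := sqr_ge0 x.2|have := sqr_ge0 x.1]; lra.
apply: compact_closedI; last exact: closed_closure.
by apply: compact_setX; exact: segment_compact.
Qed.

Lemma C2_closure_bounded (u : R * R -> R) : C2_closure u ->
  exists B, forall s x, (size s <= 2)%N -> Omega x -> `|pd s u x| <= B.
Proof.
move=> [_ _ ext].
have one s : (size s <= 2)%N -> exists B, forall x, Omega x -> `|pd s u x| <= B.
  move=> /ext[h [ch hE]].
  have : compact (h @` closure Omega).
    by apply: continuous_compact => //; exact: compact_closure_Omega.
  move=> /compact_bounded[B [_ HB]].
  exists (`|B| + 1) => x Ox; rewrite -hE; last exact/mem_set.
  apply: HB; first by rewrite ltr_pwDr// ler_norm.
  by exists x => //; exact: subset_closure.
pose S := [:: [::]; [:: false]; [:: true]; [:: false; false]; [:: false; true]; [:: true; false]; [:: true; true]].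
have [B HB] : exists B, forall s x, s \in S -> Omega x -> `|pd s u x| <= B.
  have : all (fun s => size s <= 2)%N S by [].
  elim: S => [_|s S IH /= /andP[/one[B1 h1] /IH[B2 h2]]]; first by exists 0.
  exists (Num.max B1 B2) => r x; rewrite inE => /predU1P[->|rS] Ox; rewrite le_max.
    by rewrite h1.
  by rewrite h2// orbT.
exists B => s x s2; apply: HB.
by case: s s2 => [|[] [|[] []]].
Qed.

End DiskClosure.

(** * The radial profile of a solution *)

Section RadialProfile.
Context {R : realType}.
Implicit Types (r s t : R) (x : R * R).
Variables (p : R) (u : R * R -> R).
Hypothesis p3 : 3 <= p.
Hypothesis sol : lane_emden_solution p u.
Hypothesis rad : radial u.

Definition profile s := u (Num.sqrt s, 0).

Definition slope r := pd [:: false] u (r, 0).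

(* [profile_flux s / s] is the derivative of the profile: [s] stands for [|x|^2]. *)
Definition profile_flux s := Num.sqrt s * slope (Num.sqrt s) / 2.

Let C2u : C2_closure u. Proof. by case: sol. Qed.

Lemma Omega_axis r : Omega (r, 0) <-> `|r| < 1.
Proof.
split=> [/OmegaP|h]; [|apply/OmegaP]; rewrite /sqn /= expr0n addr0.
- by rewrite -real_normK ?num_real// expr_lt1.
- by rewrite -real_normK ?num_real// expr_lt1.
Qed.

Lemma sqrt01 s : 0 < s < 1 -> 0 < Num.sqrt s < 1.
Proof.
move=> /andP[s0 s1]; rewrite sqrtr_gt0 s0 /= -[X in _ < X]sqrtr1.
by rewrite ltr_sqrt.
Qed.

Lemma profileE x : Omega x -> u x = profile (sqn x).
Proof.
move=> Ox; apply: rad; [exact: subset_closure| |].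
  apply: subset_closure; apply/Omega_axis; rewrite ger0_norm ?sqrtr_ge0//.
by rewrite /enorm /= expr0n addr0 sqrtr_sqr ger0_norm ?sqrtr_ge0.
Qed.

Lemma profile0 : profile 0 = u (0, 0).
Proof. by rewrite /profile sqrtr0. Qed.

Lemma profile1 : profile 1 = 0.
Proof.
rewrite /profile sqrtr1; have [_ _ u0] := sol; apply: u0; split.
  exact: closure_Omega_e1.
by move=> /Omega_axis; rewrite normr1 ltxx.
Qed.

Lemma pd_continuous_on w : (size w <= 2)%N -> continuous_on (pd w u).
Proof. by move=> s2 x Ox; have [[_ /(_ w x s2 Ox)]] := C2u. Qed.

Lemma pd_is_derive w i x : (size w < 2)%N -> Omega x ->
  is_derive x (edir i) (pd w u) (pd (i :: w) u x).
Proof.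
move=> s2 Ox; have [[du _] _ _] := C2u.
by apply: DeriveDef => //; exact: du.
Qed.

Lemma is_derive_axis w r : (size w < 2)%N -> `|r| < 1 ->
  is_derive r (1 : R) (fun t => pd w u (t, 0)) (pd (false :: w) u (r, 0)).
Proof.
move=> s2 r1; have Or := (Omega_axis r).2 r1.
by have /is_derive_line := pd_is_derive false s2 Or.
Qed.

Lemma is_derive_profile s : 0 < s < 1 ->
  is_derive s (1 : R) profile (profile_flux s / s).
Proof.
move=> s01; have /andP[r0 r1] := sqrt01 s01; have /andP[s0 _] := s01.
have rn : `|Num.sqrt s| < 1 by rewrite gtr0_norm.
have := is_derive1_comp (is_derive_axis (w := [::]) isT rn) (is_derive1_sqrt s0).
move/is_derive_eq; apply; rewrite /profile_flux /slope.
have E : s = Num.sqrt s ^+ 2 by rewrite sqr_sqrtr// ltW.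
rewrite [in X in _ = _ / X]E; move: (Num.sqrt s) r0 => r r0.
by field; rewrite gt_eqF.
Qed.

Lemma is_derive_slope r : `|r| < 1 -> is_derive r (1 : R) slope (pd [:: false; false] u (r, 0)).
Proof. by move=> r1; exact: (is_derive_axis (w := [:: false]) isT r1). Qed.

Lemma pd_radial i x : Omega x -> 0 < sqn x ->
  pd [:: i] u x = 2 * pcoord i x * (profile_flux (sqn x) / sqn x).
Proof.
move=> Ox x0.
have x01 : 0 < sqn x < 1 by rewrite x0; exact/OmegaP.
have := is_derive_comp_dir (is_derive_sqn x i) (is_derive_profile x01).
move=> h; rewrite /pd /= mulrC.
rewrite -(@derive_val _ _ _ _ _ _ _ h); apply: near_eq_derive.
near=> y; apply: profileE; near: y.
by apply: open_nbhs_nbhs; split => //; exact: open_Omega.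
Unshelve. all: by end_near.
Qed.

Lemma is_derive_profile_flux_gen s : 0 < s < 1 -> is_derive s (1 : R) profile_flux
  ((slope (Num.sqrt s) + Num.sqrt s * pd [:: false; false] u (Num.sqrt s, 0)) / (4 * Num.sqrt s)).
Proof.
move=> s01; have /andP[r0 r1] := sqrt01 s01; have /andP[s0 _] := s01.
have rn : `|Num.sqrt s| < 1 by rewrite gtr0_norm.
have d1 := is_derive1_sqrt s0.
have d2 := is_derive1_comp (is_derive_slope rn) d1.
set a := pd [:: false; false] u _ in d2 *.
have := is_deriveZ 2^-1 (is_deriveM d1 d2).
have -> : 2^-1 \*: (Num.sqrt * (slope \o Num.sqrt)) = profile_flux.
  by apply/funext => t; exact: mulrC.
move/is_derive_eq; apply; rewrite /GRing.scale /=.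
move: (slope _) => b; clearbody a; move: (Num.sqrt s) r0 => r r0.
by field; rewrite gt_eqF.
Qed.

(** The term u_r / r of the radial Laplacian: the second partial derivative of u is 2 x_2 W (|x|^2)
    with W = P / s, and on the axis x_2 = 0 only the derivative of the factor x_2 survives. *)
Lemma pd11_axis r : 0 < r < 1 -> pd [:: true; true] u (r, 0) = slope r / r.
Proof.
move=> /andP[r0 r1]; have rn : `|r| < 1 by rewrite gtr0_norm.
have s01 : 0 < r ^+ 2 < 1 by rewrite exprn_gt0//= expr_lt1// ltW.
have Or : Omega (r, 0) by exact/Omega_axis.
have sq : sqn (r, 0) = r ^+ 2 by rewrite /sqn /= expr0n addr0.
have s01' : 0 < sqn (r, 0) < 1 by rewrite sq.
have nz : sqn (r, 0) != 0 by rewrite gt_eqF// sq exprn_gt0.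
have dW := is_deriveM (is_derive_profile_flux_gen s01') (@is_deriveV R id _ _ _ nz (is_derive_id (sqn (r, 0)) (1 : R))).
have d1 := is_derive_comp_dir (is_derive_sqn (r, 0) true) dW.
have d2 := is_deriveM (is_deriveZ 2 (is_derive_pcoord (r, 0) true true)) d1.
have E : pd [:: true; true] u (r, 0) =
    'D_(edir true) ((2 \*: pcoord true) * ((profile_flux * (fun y => (id y)^-1)) \o sqn)) (r, 0).
  rewrite /pd /=; apply: near_eq_derive.
  near=> y; rewrite -[LHS]/(pd [:: true] u y) pd_radial//; near: y.
  - by apply: open_nbhs_nbhs; split => //; exact: open_Omega.
  - have := @continuous_sqn R (r, 0) => /cvgr_gt; apply.
    by rewrite sq exprn_gt0.
rewrite E (@derive_val _ _ _ _ _ _ _ d2) /GRing.scale /= [2 *: 0]mulr0 mul0r add0r.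
rewrite fctE sq /profile_flux sqrtr_sqr gtr0_norm//.
by field; rewrite gt_eqF.
Unshelve. all: by end_near.
Qed.

Lemma laplacianE x : laplacian u x = pd [:: false; false] u x + pd [:: true; true] u x.
Proof. by rewrite /laplacian big_bool addrC. Qed.

Lemma is_derive_profile_flux s : 0 < s < 1 -> is_derive s (1 : R) profile_flux
  (- (`|profile s| `^ (p - 1) * profile s) / 4).
Proof.
move=> s01; have h := is_derive_profile_flux_gen s01.
apply: is_derive_eq h _; have r01 := sqrt01 s01; have /andP[r0 r1] := r01.
have rn : `|Num.sqrt s| < 1 by rewrite gtr0_norm.
have [_ eqn _] := sol; have := eqn _ ((Omega_axis _).2 rn).
rewrite laplacianE (pd11_axis r01) -/(profile s) => <-.
move: (pd _ _ _) (slope _) => a b; move: (Num.sqrt s) r0 => r r0.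
by field; rewrite gt_eqF.
Qed.

Lemma profile_within_continuous : {within `[0, 1], continuous profile}.
Proof.
have [_ cu _] := C2u; move/subspace_continuousP : cu => cu.
apply/subspace_continuousP => s sI.
have cl t : t \in `[0, 1] -> closure Omega (Num.sqrt t, 0).
  rewrite in_itv/= => /andP[t0]; rewrite le_eqVlt => /predU1P[->|t1].
    by rewrite sqrtr1; exact: closure_Omega_e1.
  apply: subset_closure; apply/OmegaP.
  by rewrite /sqn /= expr0n addr0 sqr_sqrtr.
have := cu _ (cl _ sI); apply: cvg_comp.
move=> B /= wB.
have cs : {for s, continuous (fun t => (Num.sqrt t, 0) : R * R)}.
  apply: (@continuous_comp _ _ _ Num.sqrt (fun r => (r, 0) : R * R)).
    exact: sqrt_continuous.
  exact: (@continuous_pline R (0, 0) false).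
have H : \forall t \near s, closure Omega (Num.sqrt t, 0) -> B (Num.sqrt t, 0) := cs _ wB.
by apply: (@filterS _ (nbhs s) _ _ _ _ H) => t h tI; apply: h; exact: cl.
Qed.

(** The bound on the gradient alone gives a flux of order sqrt s. It shows that the flux vanishes at
    the centre; the equation bounds its derivative and so improves the order to s. The two estimates
    on the profile follow by the mean value theorem. *)
Lemma profile_flux_bound : exists C, [/\ forall s, 0 < s < 1 -> `|profile_flux s| <= C * s,
  forall s, 0 < s < 1 -> `|profile s - u (0, 0)| <= C * s &
  forall s, 0 < s < 1 -> `|profile s| <= C * (1 - s)].
Proof.
have [B HB] := C2_closure_bounded C2u.
have O0 : Omega (0 : R, 0 : R) by apply/Omega_axis; rewrite normr0 ltr01.
have B0 : 0 <= B by apply: le_trans (HB [::] (0, 0) isT O0).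
have Oq s : 0 < s < 1 -> Omega (Num.sqrt s, 0).
  by move=> /sqrt01/andP[? ?]; apply/Omega_axis; rewrite gtr0_norm.
pose K := B `^ (p - 1) * B.
have K0 : 0 <= K by rewrite mulr_ge0 ?powR_ge0.
have aK s : 0 < s < 1 -> `| - (`|profile s| `^ (p - 1) * profile s) / 4| <= K.
  move=> /Oq Os; have h := HB [::] _ isT Os.
  rewrite mulNr normrN normrM [X in _ * X]ger0_norm ?invr_ge0//.
  apply: (@le_trans _ _ (K * 4^-1)); last by lra.
  rewrite ler_wpM2r ?invr_ge0// normrM (ger0_norm (powR_ge0 _ _)) ler_pM ?powR_ge0//.
  by apply: ge0_ler_powR; rewrite ?nnegrE ?normr_ge0//; have := p3; lra.
have PK s : 0 < s < 1 -> `|profile_flux s| <= K * s.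
  move=> s01; have /andP[s0 s1] := s01; have /andP[r0 r1] := sqrt01 s01.
  apply: (@le_of_small _ _ _ B (Num.sqrt s)) => // e /andP[e0 er].
  have es : e ^+ 2 < s by rewrite -[X in _ < X]sqr_sqrtr ?(ltW s0)// ltr_pXn2r// nnegrE ltW.
  have e01 : 0 < e ^+ 2 < 1 by rewrite exprn_gt0//= (lt_trans es).
  have [r /andP[h1 h2]|c [c1 c2 h]] := @MVT_derive _ profile_flux
      (fun s => - (`|profile s| `^ (p - 1) * profile s) / 4) (e ^+ 2) s es.
    have /andP[e2 _] := e01.
    by apply: is_derive_profile_flux; apply/andP; split; lra.
  have /andP[e2 _] := e01.
  have c01 : 0 < c < 1 by apply/andP; split; lra.
  have := ler_normD (profile_flux s - profile_flux (e ^+ 2)) (profile_flux (e ^+ 2)).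
  rewrite subrK => hh; apply: le_trans hh _; apply: lerD.
    have se : 0 < s - e ^+ 2 by rewrite subr_gt0.
    rewrite h normrM (gtr0_norm se); apply: ler_pM => //; [exact: ltW|exact: aK|lra].
  rewrite /profile_flux sqrtr_sqr (gtr0_norm e0).
  have Oe : Omega (e, 0) by apply/Omega_axis; rewrite gtr0_norm// (lt_trans er).
  have := HB [:: false] _ isT Oe; rewrite -/(slope e) => hB.
  rewrite normrM normrM (gtr0_norm e0) [X in _ * X]ger0_norm ?invr_ge0//.
  have : e * `|slope e| <= e * B by rewrite ler_wpM2l// ltW.
  by have := mulr_ge0 (ltW e0) B0; lra.
exists K; split => // s /andP[s0 s1].
- have [c [c1 c2 E]] := MVT_open is_derive_profile profile_within_continuous (lexx 0) s0 (ltW s1).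
  rewrite -profile0 E subr0 normrM (gtr0_norm s0) ler_wpM2r ?(ltW s0)//.
  have c01 : 0 < c < 1 by rewrite c1 (lt_trans c2).
  by rewrite normrM normfV (gtr0_norm c1) ler_pdivrMr// PK.
- have [c [c1 c2 E]] := MVT_open is_derive_profile profile_within_continuous (ltW s0) s1 (lexx 1).
  move: E; rewrite profile1 sub0r => /(congr1 Num.norm); rewrite normrN => ->.
  have s10 : 0 < 1 - s by rewrite subr_gt0.
  rewrite normrM (gtr0_norm s10) ler_wpM2r ?(ltW s10)//.
  have c0 : 0 < c by lra.
  have c01 : 0 < c < 1 by rewrite c0.
  by rewrite normrM normfV (gtr0_norm c0) ler_pdivrMr// PK.
Qed.

(** A radial function is even along each axis, so this derivative is its own opposite. *)
Lemma gradient0 i : pd [:: i] u (0, 0) = 0.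
Proof.
have O0 : Omega (0 : R, 0 : R) by apply/Omega_axis; rewrite normr0 ltr01.
have d0 := pd_is_derive (w := [::]) i isT O0.
have /is_derive_line := d0; set f := fun t => _ => df.
have pc0 : pcoord i (0 : R, 0 : R) = 0 by case: (i).
rewrite pc0 in df.
have dfN : is_derive (- 0 : R) (1 : R) f (pd [:: i] u (0, 0)) by rewrite oppr0.
have := is_derive1_comp dfN (is_deriveN (is_derive_id (0 : R) (1:R))) => dN.
have dN' : is_derive (0 : R) (1 : R) f (pd [:: i] u (0, 0) * -1).
  apply: (@near_eq_is_derive R R R (f \o (- id))) => //.
  have : \forall t \near (0 : R), `|t| < 1.
    have n0 : `|h| @[h --> (0:R)] --> (0 : R) by rewrite -[X in _ --> X](normr0 R); apply: cvg_norm; exact: cvg_id.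
    by apply: (cvgr_lt _ n0); exact: ltr01.
  apply: filterS => t t1.
  have Ot r : `|r| < 1 -> Omega (pline (0, 0) i r).
    move=> r1; apply/OmegaP; rewrite /sqn /pline; case: (i) => /=; rewrite expr0n ?addr0 ?add0r -real_normK ?num_real// expr_lt1//.
  apply: rad; try (by apply: subset_closure; apply: Ot; rewrite ?normrN).
  by rewrite /enorm /pline; case: (i); rewrite /= sqrrN.
have := @derive_val _ _ _ _ _ _ _ df; rewrite (@derive_val _ _ _ _ _ _ _ dN').
by rewrite mulrN1; lra.
Qed.

Lemma gradientE i x : Omega x ->
  pd [:: i] u x = 2 * pcoord i x * (profile_flux (sqn x) / sqn x).
Proof.
move=> Ox; have := sqn_ge0 x; rewrite le_eqVlt => /predU1P[x0|]; last exact: pd_radial.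
have -> : x = (0, 0).
  move/esym/eqP: x0; rewrite /sqn paddr_eq0 ?sqr_ge0// !sqrf_eq0.
  by case: (x) => a b /= /andP[/eqP -> /eqP ->].
by rewrite gradient0; case: i; rewrite /pcoord /= mulr0 mul0r.
Qed.

End RadialProfile.

(** * Lower bound for [mu] and positivity of the mean *)

Section PowerInequalities.
Context {R : realType}.
Implicit Types (x y t p a M : R).

(** Young's inequality for the product x * 1 with exponents q and q / (q - 1). *)
Lemma bernoulli_powR q x : 1 < q -> 0 <= x -> 1 + q * (x - 1) <= x `^ q.
Proof.
move=> q1 x0; have q0 : 0 < q by lra.
have q10 : 0 < q - 1 by lra.
have qn : q != 0 by rewrite gt_eqF.
have qn1 : q - 1 != 0 by rewrite gt_eqF.
have r0 : 0 < q / (q - 1) by rewrite divr_gt0.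
have e : q^-1 + (q / (q - 1))^-1 = 1 by field; rewrite qn qn1.
have := conjugate_powR x0 ler01 q0 r0 e.
rewrite powR1 mulr1 mul1r invf_div => h.
have : q * x <= q * (x `^ q / q + (q - 1) / q) by rewrite ler_wpM2l// ltW.
have -> : q * (x `^ q / q + (q - 1) / q) = x `^ q + q - 1.
  by move: (x `^ q) => z; field.
lra.
Qed.

Lemma young_powR p a M : 1 < p -> 0 <= a -> 0 <= M ->
  p * M * a `^ (p - 1) <= M `^ p + (p - 1) * (a `^ (p - 1) * a).
Proof.
move=> p1 a0 M0; have p0 : 0 < p by lra.
have p10 : 0 < p - 1 by lra.
have pn : p != 0 by rewrite gt_eqF.
have pn1 : p - 1 != 0 by rewrite gt_eqF.
have r0 : 0 < p / (p - 1) by rewrite divr_gt0.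
have e : p^-1 + (p / (p - 1))^-1 = 1 by field; rewrite pn pn1.
have := conjugate_powR M0 (powR_ge0 a (p - 1)) p0 r0 e.
rewrite -powRrM.
have -> : (p - 1) * (p / (p - 1)) = p by field.
rewrite -[a `^ p](mulr_powRB1 a0 p0) invf_div => h.
have : p * (M * a `^ (p - 1)) <= p * (M `^ p / p + a * a `^ (p - 1) * ((p - 1) / p)).
  by rewrite ler_wpM2l// ltW.
have -> : p * (M `^ p / p + a * a `^ (p - 1) * ((p - 1) / p)) =
    M `^ p + (p - 1) * (a `^ (p - 1) * a).
  by move: (M `^ p) (a `^ (p - 1)) => X Y; field.
by rewrite mulrA.
Qed.

(** Bernoulli's inequality with half the exponent, then squared: this exceeds the direct bound 1 - y
    by y^2 / 4 and remains nonnegative up to y = 2. *)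
Lemma powR_one_sub_ge p y : 3 < p -> 0 <= y <= 2 -> (1 - y / 2) ^+ 2 <= (1 - y / p) `^ (p - 1).
Proof.
move=> p3 /andP[y0 y2]; have p0 : 0 < p by lra.
have x0 : 0 <= 1 - y / p by rewrite subr_ge0 ler_pdivrMr//; lra.
pose q := (p - 1) / 2.
have q1 : 1 < q by rewrite /q; lra.
have := bernoulli_powR q1 x0.
have -> : 1 + q * (1 - y / p - 1) = 1 - y * ((p - 1) / p) / 2 by rewrite /q; field; rewrite gt_eqF.
move=> h.
have h1 : 1 - y / 2 <= (1 - y / p) `^ q.
  apply: le_trans h; rewrite lerD2l lerN2 ler_wpM2r ?invr_ge0//.
  rewrite -[leRHS]mulr1 ler_wpM2l// ler_pdivrMr// mul1r; lra.
have -> : p - 1 = q * 2%:R by rewrite /q; field.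
rewrite powRrM powR_mulrn ?powR_ge0//.
by apply: lerXn2r; rewrite ?nnegrE ?powR_ge0//; lra.
Qed.

(* Here [h = 1 - k |x|^2 / 80] and [v] stands for [V / k]; the case [91 / 100 <= h]
   uses the tangent to [h^4] at [193 / 200], where the inequality is nearly sharp. *)
Lemma subsolution_poly (h v : R) : 0 < h -> h <= 1 -> 0 <= v ->
  (91 / 100 <= h -> (10 * h - 9) ^+ 2 <= v) ->
  0 <= 4 / 5 * (16 - 18 * h + h ^+ 2) + h ^+ 4 * (v - 1 / 100).
Proof.
move=> h0 h1 v0 hv; have h4 : 0 < h ^+ 4 by exact: exprn_gt0.
have [hl|hg] := ltP h (91 / 100).
  have h41 : h ^+ 4 <= 1 by rewrite exprn_ile1// ltW.
  have h4v : 0 <= h ^+ 4 * v by rewrite mulr_ge0// ltW.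
  (* The two roots add up to 18, so 16 - 18 h + h^2 exceeds this product by a constant of about
     0.448, which alone outweighs h^4 / 100. *)
  have hsq : 0 <= (91 / 100 - h) * (1709 / 100 - h) by rewrite mulr_ge0; lra.
  by rewrite expr2; lra.
have {}hv := hv hg.
have tang : 4 * (193 / 200) ^+ 3 * h - 3 * (193 / 200) ^+ 4 <= h ^+ 4.
  rewrite -subr_ge0.
  have -> : h ^+ 4 - (4 * (193 / 200) ^+ 3 * h - 3 * (193 / 200) ^+ 4) =
    (h - 193 / 200) ^+ 2 * (h ^+ 2 + 2 * (193 / 200) * h + 3 * (193 / 200) ^+ 2) by ring.
  apply: mulr_ge0; first exact: sqr_ge0.
  by apply: addr_ge0; [apply: addr_ge0; [exact: sqr_ge0|lra]|lra].
set w := 10 * h - 9 in hv.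
have w01 : 1 / 10 <= w by rewrite /w; lra.
(* The split at 91 / 100 makes this factor nonnegative, which allows [h ^+ 4] to be replaced by its
   tangent. *)
have w2 : 0 <= w ^+ 2 - 1 / 100.
  have : 0 <= (w - 1 / 10) * (w + 1 / 10) by rewrite mulr_ge0; lra.
  by rewrite expr2; lra.
have hh : (4 * (193 / 200) ^+ 3 * h - 3 * (193 / 200) ^+ 4) * (w ^+ 2 - 1 / 100) <= h ^+ 4 * (v - 1 / 100).
  apply: (@le_trans _ _ (h ^+ 4 * (w ^+ 2 - 1 / 100))); first by rewrite ler_wpM2r.
  by rewrite ler_wpM2l ?(ltW h4)//; lra.
apply: le_trans (lerD (lexx (4 / 5 * (16 - 18 * h + h ^+ 2))) hh).
have c1 : 0 <= (h - 193 / 200) ^+ 2 * (h - 9 / 10) by rewrite mulr_ge0 ?sqr_ge0//; lra.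
have c2 := sqr_ge0 (h - 193 / 200).
rewrite /w; lra.
Qed.

End PowerInequalities.

Section DiskMass.
Context {R : realType}.

Lemma disk_not_negligible (b : R) : 0 < b ->
  ~ {ae (@leb2 R), forall x, Omega x -> ~ sqn x < b}.
Proof.
move=> b0 [Z [mZ Z0 HZ]].
pose c := Num.min (2^-1) (b / 2).
have c0 : 0 < c by rewrite lt_min divr_gt0//=; lra.
have c1 : c <= 2^-1 by rewrite ge_min lexx.
have c2 : c <= b / 2 by rewrite ge_min lexx orbT.
clearbody c.
pose I : set R := `[0, c]%classic.
have mI : measurable I by exact: measurable_itv.
have IZ : I `*` I `<=` Z.
  move=> x [/=]; rewrite /I /= !in_itv/= => /andP[x0 xc] /andP[y0 yc].
  have h : sqn x <= c.
    have e1 : x.1 ^+ 2 <= 2^-1 * c by rewrite expr2 ler_pM//; lra.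
    have e2 : x.2 ^+ 2 <= 2^-1 * c by rewrite expr2 ler_pM//; lra.
    by rewrite /sqn; lra.
  apply: HZ => /= H; apply: H; last by lra.
  by apply/OmegaP; lra.
have : (leb2 (I `*` I) <= 0)%E.
  rewrite -[X in (_ <= X)%E]Z0; apply: le_measure; rewrite ?inE//.
  exact: measurableX.
have -> : leb2 (I `*` I) = (lebesgue_measure I * lebesgue_measure I)%E.
  exact: product_measure1E.
rewrite lebesgue_measure_itv/= lte_fin c0 -EFinB subr0 -EFinM lee_fin.
by rewrite leNgt mulr_gt0.
Qed.

End DiskMass.

(** Here s = b - |x|^2, e = exp (-16 b / s), v = V (x), (a, c) = x and kappa = 80 / b. The left side
    is lap psi + (V - kappa / 100) psi for psi = e; the right side is the polynomial of
    [subsolution_poly] at h = s / b, times a positive factor. The coefficient 4 / 5 is 4 * 16 /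
    80. *)
Lemma subsolution_identity (K : realFieldType) (b s e v a c : K) : b != 0 -> s != 0 ->
  a * a + c * c = b - s ->
  (16 * b * (s^-1 ^+ 2 * e) * - 2 +
    - 2 * a * (16 * b * ((16 * b * (s^-1 ^+ 4 * e) - 2%:R * (s^-1 ^+ 3 * e)) * (- 2 * a)))) +
  (16 * b * (s^-1 ^+ 2 * e) * - 2 +
    - 2 * c * (16 * b * ((16 * b * (s^-1 ^+ 4 * e) - 2%:R * (s^-1 ^+ 3 * e)) * (- 2 * c)))) +
  (v - 80 / b / 100) * (s^-1 ^+ 0 * e) =
  e * (80 / b) / (s / b) ^+ 4 * (4 / 5 * (16 - 18 * (s / b) + (s / b) ^+ 2) +
    (s / b) ^+ 4 * (v / (80 / b) - 1 / 100)).
Proof.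
move=> b0 s0 ac.
transitivity (64 * b * (- s^-1 ^+ 2 * e + (a * a + c * c) * (16 * b * s^-1 ^+ 4 * e - 2 * s^-1 ^+ 3 * e))
   + (v - 80 / b / 100) * e).
  by rewrite expr0 mul1r; move: (s^-1) (80 / b / 100) => si z; ring.
rewrite ac.
by field; rewrite b0 s0.
Qed.

(** * The lower bound for minus the first eigenvalue *)

Section FirstEigenvalue.
Context {R : realType}.
Implicit Types (x : R * R).
Variables (p mu : R) (u phi : R * R -> R) (G g : bool -> R * R -> R).
Hypothesis p3 : 300 * 300 < p.
Hypothesis sol : lane_emden_solution p u.
Hypothesis rad : radial u.
Hypothesis u0_gt0 : 0 < u (0, 0).
Hypothesis gd : green_data phi G g.
Hypothesis phi_gt0 : {ae (@leb2 R), forall x, Omega x -> 0 < phi x}.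
Hypothesis phi_eq : {ae (@leb2 R), forall x, Omega x ->
  g false x + g true x = (mu - p * `|u x| `^ (p - 1)) * phi x}.

Let u0 := u (0, 0).
Let kappa := p * u0 `^ (p - 1).
Let p3' : 3 <= p. Proof. by move: p3; lra. Qed.

Let O0 : Omega (0 : R, 0 : R).
Proof. by apply/OmegaP; rewrite /sqn /= expr0n addr0. Qed.

Lemma solution_bounds :
  [/\ forall x, Omega x -> u0 - u0 `^ p / 4 * sqn x <= u x, 4 <= u0 `^ (p - 1) &
    forall x, Omega x -> u x < 0 -> `|u x| `^ (p + 1) <= 2 / (p + 1) * u0 `^ (p + 1)].
Proof.
have [C [PC NC0 NC1]] := profile_flux_bound p3' sol rad.
have dN := is_derive_profile sol.
have dP := is_derive_profile_flux sol rad.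
have u00 : profile u 0 = u0 by exact: profile0.
split.
- move=> x Ox; rewrite (profileE rad Ox).
  have := sqn_ge0 x; rewrite le_eqVlt => /predU1P[<-|x0].
    by rewrite mulr0 subr0 -u00.
  apply: (radial_ge p3' u0_gt0 dN dP PC NC0); rewrite x0; exact/OmegaP.
- exact: (radial_height p3' u0_gt0 dN dP PC NC0 NC1).
- move=> x Ox; rewrite (profileE rad Ox) => Nneg.
  have x0 : 0 < sqn x.
    rewrite lt_neqAle sqn_ge0 andbT; apply/eqP => x0.
    by move: Nneg; rewrite -x0 u00 ltNge (ltW u0_gt0).
  by apply: (radial_negative_bound p3' u0_gt0 dN dP PC NC0 NC1) => //; rewrite x0; exact/OmegaP.
Qed.

Lemma bmeas_u : bmeas u.
Proof.
have C2u : C2_closure u by case: sol.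
have [B HB] := C2_closure_bounded C2u.
apply: (@continuous_bmeas _ _ B) => x Ox; last exact: (HB [::] x isT Ox).
exact: (pd_continuous_on sol (w := [::]) isT Ox).
Qed.

Lemma bmeas_powR_norm k q : bmeas k -> 0 <= q -> bmeas (fun x : R * R => `|k x| `^ q).
Proof.
move=> [mk [B HB]] q0; split.
  apply: (measurableT_comp (measurable_powR q)).
  exact: measurableT_comp mk.
exists (B `^ q) => x Ox; have h := HB x Ox.
rewrite ger0_norm ?powR_ge0//; apply: ge0_ler_powR; rewrite ?nnegrE//.
exact: le_trans h.
Qed.

Let V x := p * `|u x| `^ (p - 1).

Lemma bmeas_potential : bmeas V.
Proof.
apply: bmeasM; first exact: bmeas_cst.
by apply: bmeas_powR_norm; [exact: bmeas_u|move: p3; lra].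
Qed.

Lemma intO_lapl k : bmeas k ->
  intO (fun x => (g false x + g true x) * k x) = intO (fun x => phi x * ((mu - V x) * k x)).
Proof.
move=> bk; have [p1 _ g1] := green_data_L1 gd.
apply: intO_ae_eq.
- by apply: L1M => //; exact: L1D.
- apply: L1M => //; apply: bmeasM => //.
  by apply: bmeasB; [exact: bmeas_cst|exact: bmeas_potential].
- by apply: ae_imply phi_eq => x h Ox; rewrite h//; rewrite /V; ring.
Qed.

(* [phi] is tested against [exp (-16 / h)] with [h = 1 - sqn x / b]. *)
Lemma eigenvalue_lower : kappa / 100 <= mu.
Proof.
have [ulow u04 _] := solution_bounds.
have p0 : 0 < p by move: p3; lra.
(* This keeps the support |x|^2 <= 80 / kappa inside the disk; it rests on [u0 ^ (p - 1) >= 4]. *)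
have k80 : 80 < kappa.
  have : p * 4 <= kappa by rewrite /kappa ler_wpM2l// ltW.
  by move: p3; lra.
have kap0 : 0 < kappa by lra.
pose b := 80 / kappa; have b0 : 0 < b by rewrite divr_gt0.
have b1 : b < 1 by rewrite /b ltr_pdivrMr// mul1r; lra.
pose d := 16 * b; have d0 : 0 < d by rewrite mulr_gt0.
pose psi x := expbump d 0 (b - sqn x).
have spsi : smoothf psi by exact: smooth_expbump.
have [cK KO] := disk_compact b1.
have psi0 x : b <= sqn x -> psi x = 0 by move=> h; rewrite /psi expbump_npos// subr_le0.
have tpsi : test_function psi.
  by apply: (smoothf_test spsi cK KO) => x /= /negP; rewrite -ltNge => /ltW; exact: psi0.
pose dpsi i x := (d * expbump d 2 (b - sqn x)) * (- 2 * pcoord i x).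
have E1 i : pd [:: i] psi = dpsi i.
  apply: pd1_is_derive => x.
  have := is_derive_expbump_sqn 0 b x i d0; move/is_derive_eq; apply.
  by rewrite mul0r subr0.
pose D i x := (d * expbump d 2 (b - sqn x)) * - 2 +
  (- 2 * pcoord i x) * (d * ((d * expbump d 4 (b - sqn x) - 2%:R * expbump d 3 (b - sqn x)) * (- 2 * pcoord i x))).
have E2 i : pd [:: i; i] psi = D i.
  rewrite -[LHS]/(pd [:: i] (pd [:: i] psi)) E1; apply: pd1_is_derive => x.
  have d1 := is_deriveZ d (is_derive_expbump_sqn 2 b x i d0).
  have d2 := is_deriveZ (- 2) (is_derive_pcoord x i i).
  have := is_deriveM d1 d2; move/is_derive_eq; apply.
  by rewrite eqxx /D /GRing.scale /= mulr1.
pose L x := D false x + D true x.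
have Lpsi x : Omega x -> 0 <= L x + (V x - kappa / 100) * psi x.
  move=> Ox; have [bx|xb] := leP b (sqn x).
    have s0 : b - sqn x <= 0 by rewrite subr_le0.
    by rewrite /L /D psi0// !expbump_npos// !(mulr0, mul0r, subr0, addr0).
  have s0 : 0 < b - sqn x by rewrite subr_gt0.
  pose h := (b - sqn x) / b.
  have h0 : 0 < h by rewrite divr_gt0.
  have h1 : h <= 1 by rewrite ler_pdivrMr// mul1r; have := sqn_ge0 x; lra.
  have V0 : 0 <= V x / kappa by rewrite divr_ge0 ?(ltW kap0)// mulr_ge0 ?powR_ge0// ltW.
  have hv : 91 / 100 <= h -> (10 * h - 9) ^+ 2 <= V x / kappa.
    (* In terms of |x| this is y = kappa |x|^2 / 4, for which [ulow] reads u >= u0 (1 - y / p). The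
       factor 10 h - 9 is 1 - y / 2. *)
    move=> h91; pose y := 20 * (1 - h).
    have y2 : 0 <= y <= 2 by apply/andP; split; rewrite /y; lra.
    have p3r : 3 < p by move: p3; lra.
    have := powR_one_sub_ge p3r y2.
    have -> : 1 - y / 2 = 10 * h - 9 by rewrite /y; lra.
    move=> H; apply: le_trans H _.
    rewrite /V /kappa -mulf_div divff ?gt_eqF// mul1r ler_pdivlMr; last by lra.
    have y0 : 0 <= 1 - y / p.
      have /andP[_ y2'] := y2.
      by rewrite subr_ge0 ler_pdivrMr// mul1r; lra.
    rewrite -powRM//; last exact: ltW.
    have hu : (1 - y / p) * u0 <= u x.
      apply: le_trans (ulow x Ox); rewrite le_eqVlt; apply/orP; left; apply/eqP.
      have -> : u0 `^ p = u0 `^ (p - 1) * u0.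
        by rewrite mulrC mulr_powRB1// ltW.
      rewrite /y /h /b /kappa; field.
      by rewrite !gt_eqF//; lra.
    apply: ge0_ler_powR; rewrite ?nnegrE ?normr_ge0//.
    - by move: p3; lra.
    - by rewrite mulr_ge0// ltW.
    - exact: le_trans hu (ler_norm _).
  have := subsolution_poly h0 h1 V0 hv.
  set P := 4 / 5 * _ + _ => P0.
  suff -> : L x + (V x - kappa / 100) * psi x = expR (- (d / (b - sqn x))) * kappa / h ^+ 4 * P.
    apply: mulr_ge0 => //; apply: divr_ge0; first by apply: mulr_ge0; [exact: expR_ge0|exact: ltW].
    by apply: exprn_ge0; exact: ltW.
  rewrite /L /D /psi !expbump_pos// /P /h /d.
  have -> : kappa = 80 / b by rewrite /b invf_div mulrCA divff ?mulr1// gt_eqF.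
  have sE : pcoord false x * pcoord false x + pcoord true x * pcoord true x = b - (b - sqn x).
    by rewrite /sqn /pcoord !expr2; ring.
  move: (b - sqn x) s0 sE => s s0 sE.
  move: (expR _) (V x) (pcoord false x) (pcoord true x) sE => e v a c sE.
  by apply: subsolution_identity => //; rewrite gt_eqF.
have [p1 G1 g1] := green_data_L1 gd.
have bpsi : bmeas psi := test_bmeas [::] tpsi.
have bD i : bmeas (D i) by rewrite -E2; exact: test_bmeas.
have bL : bmeas L by exact: bmeasD.
have I0 : intO (fun x => phi x * L x) = intO (fun x => phi x * ((mu - V x) * psi x)).
  rewrite -intO_lapl//.
  transitivity (intO (fun x => phi x * D false x) + intO (fun x => phi x * D true x)).
    by rewrite -intOD; [apply: eq_intO => x _; exact: mulrDr|exact: L1M|exact: L1M].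
  have w i : intO (fun x => phi x * D i x) = intO (fun x => g i x * psi x).
    by rewrite -E2 (weak_second_test gd i tpsi).1.
  rewrite !w -intOD; [|exact: L1M..].
  by apply: eq_intO => x _; rewrite mulrDl.
have bV := bmeas_potential.
have bVp : bmeas (fun x => (mu - V x) * psi x).
  by apply: bmeasM => //; apply: bmeasB => //; exact: bmeas_cst.
have bQ : bmeas (fun x => L x + (V x - kappa / 100) * psi x).
  by apply: bmeasD => //; apply: bmeasM => //; apply: bmeasB => //; exact: bmeas_cst.
(* Green's formula for [psi] cancels the terms in [L] and [V], leaving mu - kappa / 100 times a
   positive integral; the subsolution property makes the left side nonnegative. *)
have E : intO (fun x => phi x * (L x + (V x - kappa / 100) * psi x)) =
    (mu - kappa / 100) * intO (fun x => phi x * psi x).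
  rewrite -intOZ; last exact: L1M.
  transitivity (intO (fun x => phi x * L x) - intO (fun x => phi x * ((mu - V x) * psi x))
    + intO (fun x => (mu - kappa / 100) * (phi x * psi x))).
    rewrite -intOB; [|exact: L1M..]; rewrite -intOD; last 2 first.
    - by apply: L1B; exact: L1M.
    - by apply: L1Z; exact: L1M.
    by apply: eq_intO => x _; ring.
  by rewrite I0 subrr add0r.
have psi_ge0 x : 0 <= psi x.
  by rewrite /psi /expbump; case: ifP => // s0; rewrite mulr_ge0 ?expR_ge0// exprn_ge0// invr_ge0 ltW.
have I1 : 0 < intO (fun x => phi x * psi x).
  apply: intO_gt0; first exact: L1M.
    by apply: ae_imply phi_gt0 => x h Ox; rewrite mulr_ge0// ltW// h.
  move=> H; apply: (disk_not_negligible b0).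
  apply: ae_imply2 H phi_gt0 => x H ph Ox xb; have := H Ox; apply/eqP.
  by rewrite gt_eqF// mulr_gt0 ?ph// /psi expbump_pos ?subr_gt0// expr0 mul1r expR_gt0.
have I2 : 0 <= intO (fun x => phi x * (L x + (V x - kappa / 100) * psi x)).
  rewrite -intO0; apply: le_intO_ae; [exact/bmeas_L1/bmeas_cst|exact: L1M|].
  by apply: ae_imply phi_gt0 => x h Ox; rewrite mulr_ge0 ?Lpsi// ltW// h.
by move: I2; rewrite E pmulr_lge0// subr_ge0.
Qed.

End FirstEigenvalue.

(** * The comparison function and the sign of the mean *)

Section PositiveMean.
Context {R : realType}.
Implicit Types (x : R * R).

Lemma negative_bound_small (p u0 : R) : 300 * 300 < p -> 0 < u0 ->
  exists M, [/\ 0 < M, M `^ (p + 1) = 2 / (p + 1) * u0 `^ (p + 1) &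
    2 * p * M `^ (p - 1) < p * u0 `^ (p - 1) / 100].
Proof.
move=> p3 u0_gt0; have p1 : 0 < p + 1 by lra.
have p0 : 0 < p by lra.
pose z := 2 / (p + 1); have z0 : 0 < z by rewrite divr_gt0.
(* The origin of the threshold on [p]: since (p - 1) / (p + 1) >= 1 / 2, the power M^(p-1) is at
   most u0^(p-1) sqrt z, and sqrt z < 1 / 200 amounts to p + 1 > 80000, which 300 * 300 ensures. *)
have z1 : z < (200^-1) ^+ 2 by rewrite /z ltr_pdivrMr// expr2; lra.
have z11 : z <= 1 by apply: le_trans (ltW z1) _; rewrite expr2; lra.
have w0 : 0 < u0 `^ (p - 1) by exact: powR_gt0.
exists (u0 * z `^ (p + 1)^-1); split.
- by rewrite mulr_gt0// powR_gt0.
- rewrite powRM ?powR_ge0 ?(ltW u0_gt0)// -powRrM mulVf ?gt_eqF// powRr1 1?mulrC//.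
  exact: ltW.
- rewrite powRM ?powR_ge0 ?(ltW u0_gt0)// -powRrM.
  have h : z `^ ((p + 1)^-1 * (p - 1)) < 200^-1.
    apply: (@le_lt_trans _ _ (z `^ 2^-1)).
      apply: ger_powR; first by rewrite z0.
      by rewrite mulrC ler_pdivlMr//; lra.
    rewrite powR12_sqrt ?(ltW z0)//.
    have -> : 200^-1 = Num.sqrt ((200^-1) ^+ 2) :> R.
      by rewrite sqrtr_sqr ger0_norm// invr_ge0.
    by rewrite ltr_sqrt.
  have : p * u0 `^ (p - 1) * z `^ ((p + 1)^-1 * (p - 1)) < p * u0 `^ (p - 1) * 200^-1.
    by rewrite ltr_pM2l// mulr_gt0.
  lra.
Qed.

(* [n2] stands for [4 n^2], [t] for [|x|^(2n-2)] and [th] for [1 - |x|^(2n)]. *)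
Lemma bracket_gt0 (p mu M v t th n2 : R) : 1 < p -> 0 < M ->
  2 * p * M `^ (p - 1) < mu -> (p - 1) * M `^ (p - 1) <= n2 ->
  0 <= t -> 0 < th <= 1 -> 1 - th <= t -> (v < 0 -> `|v| <= M) ->
  0 < (p - 1) * (`|v| `^ (p - 1) * v) + M * (n2 * t + (mu - p * `|v| `^ (p - 1)) * th).
Proof.
move=> p1 M0 Mmu Mn t0 /andP[th0 th1] tht vM.
have p0 : 0 < p by lra.
have W0 : 0 < M `^ (p - 1) by exact: powR_gt0.
set W := M `^ (p - 1) in Mmu Mn W0.
have MW : M `^ p = M * W by rewrite -mulr_powRB1// ltW.
have a0 : 0 <= `|v| `^ (p - 1) by exact: powR_ge0.
have pW : W <= p * W by rewrite -[leLHS]mul1r ler_wpM2r ?ltW.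
have n20 : 0 <= n2 by apply: le_trans Mn; rewrite mulr_ge0// ltW//; lra.
have Mth : 0 < M * th by exact: mulr_gt0.
have [v0|v0] := leP 0 v.
  rewrite (ger0_norm v0) in a0 *.
  (* Where [v] is nonnegative the potential may exceed [mu]; Young's inequality pays for p M v^(p-1)
     with (p - 1) v^p, at the price of M^p, which [mu] covers. *)
  have := young_powR p1 v0 (ltW M0); rewrite MW.
  set a := v `^ (p - 1) in a0 * => y.
  have y2 : p * M * a * th <= (M * W + (p - 1) * (a * v)) * th by rewrite ler_wpM2r// ltW.
  have h1 : 0 <= M * (n2 * t) by rewrite !mulr_ge0// ltW.
  have h2 : 0 <= (p - 1) * (a * v) * (1 - th) by rewrite !mulr_ge0//; lra.
  have h3 : 0 < M * th * (mu - W) by rewrite mulr_gt0//; lra.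
  lra.
(* Where [v] is negative the loss is at most (p - 1) W M, split as th + (1 - th). The share of 1 -
   th <= t is paid by [n2 * t]; the share of [th], together with the potential p W, is paid by mu >
   2 p W. *)
have {}vM := vM v0.
rewrite (ltr0_norm v0) in a0 vM *.
have aW : (- v) `^ (p - 1) <= W.
  by apply: ge0_ler_powR; rewrite ?nnegrE ?(ltW M0)//; lra.
set a := (- v) `^ (p - 1) in a0 aW *.
have h1 : a * (- v) <= W * M by rewrite ler_pM//; lra.
have h2 : (p - 1) * (a * - v) <= (p - 1) * (W * M) by rewrite ler_wpM2l//; lra.
have h3 : M * th * (p * a) <= M * th * (p * W).
  by apply: ler_wpM2l; [exact: ltW|apply: ler_wpM2l => //; exact: ltW].
have h4 : M * t * ((p - 1) * W) <= M * t * n2 by rewrite ler_wpM2l// mulr_ge0// ltW.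
have h5 : (p - 1) * (W * M) * (1 - th) <= (p - 1) * (W * M) * t.
  by rewrite ler_wpM2l// !mulr_ge0// ltW//; lra.
have h6 : 0 < M * th * (mu - 2 * p * W) by rewrite mulr_gt0//; lra.
have h7 : 0 <= M * th * W by rewrite mulr_ge0// ltW.
lra.
Qed.

Variables (p mu : R) (u phi : R * R -> R) (G g : bool -> R * R -> R).
Hypothesis p3 : 300 * 300 < p.
Hypothesis sol : lane_emden_solution p u.
Hypothesis rad : radial u.
Hypothesis u0_gt0 : 0 < u (0, 0).
Hypothesis gd : green_data phi G g.
Hypothesis phi_gt0 : {ae (@leb2 R), forall x, Omega x -> 0 < phi x}.
Hypothesis phi_eq : {ae (@leb2 R), forall x, Omega x ->
  g false x + g true x = (mu - p * `|u x| `^ (p - 1)) * phi x}.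
Hypothesis phi_n0 : ~ {ae (@leb2 R), forall x, Omega x -> phi x = 0}.

Lemma green_solution :
  intO (fun x => phi x * - (`|u x| `^ (p - 1) * u x)) =
  intO (fun x => (g false x + g true x) * u x).
Proof.
have p3' : 3 <= p by move: p3; lra.
have C2u : C2_closure u by case: sol.
have [B HB] := C2_closure_bounded C2u.
have [C [PC NC0 NC1]] := profile_flux_bound p3' sol rad.
have N'C (s : R) : 0 < s < 1 -> `|profile_flux u s / s| <= `|B| + `|C|.
  move=> s01; have /andP[s0 _] := s01; rewrite normrM normfV (gtr0_norm s0) ler_pdivrMr//.
  apply: le_trans (PC s s01) _; rewrite ler_wpM2r ?(ltW s0)//.
  by apply: le_trans (ler_norm _) _; rewrite lerDr.
have HB' i j x : Omega x -> `|pd [:: i] u x| <= `|B| + `|C| /\ `|pd [:: i; j] u x| <= `|B| + `|C|.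
  move=> Ox; have BB : B <= `|B| + `|C| by apply: le_trans (ler_norm _) _; rewrite lerDl.
  by split; apply: le_trans BB; exact: HB.
have cN' (s : R) : 0 < s < 1 -> {for s, continuous (fun s => profile_flux u s / s)}.
  move=> s01; have /andP[s0 _] := s01; apply: cvgM.
    apply/differentiable_continuous/derivable1_diffP.
    by have [] := is_derive_profile_flux sol rad s01.
  by apply: cvgV; [rewrite gt_eqF|exact: cvg_id].
have := green_identity gd (is_derive_profile sol) (profile_within_continuous sol) (profile1 sol)
  N'C cN' (X := fun i => pd [:: i] u) (D := fun i => pd [:: i; i] u)
  (fun i => pd_continuous_on sol (w := [:: i]) isT)
  (fun i => pd_continuous_on sol (w := [:: i; i]) isT)
  (fun i x Ox => pd_is_derive sol (w := [:: i]) i isT Ox)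
  (fun i x Ox => (HB' i i x Ox).1) (fun i x Ox => (HB' i i x Ox).2)
  (fun i x Ox => gradientE sol rad i Ox).
move=> E; transitivity (intO (fun x => phi x * (pd [:: false; false] u x + pd [:: true; true] u x))).
  apply: eq_intO => x Ox; rewrite -laplacianE; have [_ eqn _] := sol.
  by rewrite -(eqn x Ox) opprK.
by rewrite E; apply: eq_intO => x Ox; rewrite -(profileE rad Ox).
Qed.

Lemma pcoord_le1 i x : Omega x -> `|pcoord i x| <= 1.
Proof.
by move=> Ox; rewrite ler_norml; case: i; [have := Omega_snd Ox|have := Omega_fst Ox]; rewrite in_itv.
Qed.

Lemma is_derive_sqnX n i x :
  is_derive x (edir i) (fun y => sqn y ^+ n.+1) (n.+1%:R * sqn x ^+ n * (2 * pcoord i x)).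
Proof.
have := is_deriveX n.+1 (is_derive_sqn x i).
have -> : (@sqn R) ^+ n.+1 = (fun y => sqn y ^+ n.+1) by apply/funext => y; rewrite exprfctE.
by [].
Qed.

(** Green's formula for the barrier, as the Laplacian of |x|^(2m) is 4 m^2 |x|^(2m-2). Taking m = n
    + 2 keeps the exponents of both derivatives free of truncated subtraction. *)
Lemma green_power n :
  intO (fun x => phi x * - (4 * n.+2%:R ^+ 2 * sqn x ^+ n.+1)) =
  intO (fun x => (g false x + g true x) * (1 - sqn x ^+ n.+2)).
Proof.
pose X i x := - (n.+2%:R * sqn x ^+ n.+1) * (2 * pcoord i x) : R.
pose D i x := - (2 * n.+2%:R * sqn x ^+ n.+1 + 4 * n.+2%:R * n.+1%:R * sqn x ^+ n * pcoord i x ^+ 2) : R.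
pose N (s : R) := 1 - s ^+ n.+2; pose N' (s : R) := - (n.+2%:R * s ^+ n.+1).
pose C : R := 4 * n.+2%:R ^+ 2.
have n1 : n.+1%:R = n.+2%:R - 1 :> R by rewrite -[n.+2]addn1 natrD addrK.
have n2 : 2 <= n.+2%:R :> R by rewrite ler_nat.
have cq k : continuous (fun x : R * R => sqn x ^+ k).
  move=> x; apply: (@continuous_comp _ _ _ (@sqn R) (fun t => t ^+ k)).
    exact: continuous_sqn.
  exact: exprn_continuous.
have cc i := @continuous_pcoord R i.
have cX i : continuous_on (X i).
  move=> x _; apply: cvgM; last by apply: cvgM; [exact: cvg_cst|exact: cc].
  by apply: cvgN; apply: cvgM; [exact: cvg_cst|exact: cq].
have cD i : continuous_on (D i).
  move=> x _; apply: cvgN; apply: cvgD.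
    by apply: cvgM; [exact: cvg_cst|exact: cq].
  apply: cvgM; first by apply: cvgM; [exact: cvg_cst|exact: cq].
  by rewrite expr2; under eq_fun do rewrite expr2; apply: cvgM; exact: cc.
have dX i x : Omega x -> is_derive x (edir i) (X i) (D i x).
  move=> _.
  have d1 := is_deriveN (is_deriveZ n.+2%:R (is_derive_sqnX n i x)).
  have d2 := is_deriveZ 2 (is_derive_pcoord x i i).
  have := is_deriveM d1 d2; move/is_derive_eq; apply.
  rewrite eqxx /D /GRing.scale /= -[X in X * (2 * 1)]/(- (n.+2%:R * sqn x ^+ n.+1)).
  rewrite -[2 *: pcoord i x]/(2 * pcoord i x) !exprS expr0.
  by move: (sqn x ^+ n) (n.+1%:R) (n.+2%:R) => a b c; ring.
have unit01 (s : R) k : 0 <= s <= 1 -> 0 <= s ^+ k <= 1.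
  by move=> /andP[s0 s1]; rewrite exprn_ge0//= exprn_ile1.
have q01 x : Omega x -> 0 <= sqn x <= 1 by move=> /OmegaP/ltW h; rewrite sqn_ge0.
have NC (s : R) : 0 <= s <= 1 -> `|N' s| <= n.+2%:R.
  move=> /unit01-/(_ n.+1)/andP[a0 a1]; rewrite /N' normrN ger0_norm ?mulr_ge0//.
  by rewrite -[leRHS]mulr1 ler_wpM2l.
have C2 : 2 * n.+2%:R <= C.
  have : n.+2%:R * 2 <= n.+2%:R * n.+2%:R :> R by rewrite ler_wpM2l.
  by rewrite /C expr2; lra.
have XC i x : Omega x -> `|X i x| <= C.
  move=> Ox; have h := NC _ (q01 x Ox); have hc := pcoord_le1 i Ox.
  apply: le_trans C2; rewrite mulrC /X normrM; apply: ler_pM => //.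
  by rewrite normrM ger0_norm//; lra.
have DC i x : Omega x -> `|D i x| <= C.
  move=> Ox; have hc := pcoord_le1 i Ox.
  have /andP[a0 a1] := unit01 _ n.+1 (q01 x Ox); have /andP[b0 b1] := unit01 _ n (q01 x Ox).
  have c1 : pcoord i x ^+ 2 <= 1 by rewrite -real_normK ?num_real// exprn_ile1.
  have c0 := sqr_ge0 (pcoord i x).
  have e1 : 2 * n.+2%:R * sqn x ^+ n.+1 <= 2 * n.+2%:R * 1 by rewrite ler_wpM2l.
  have e2 : 4 * n.+2%:R * n.+1%:R * (sqn x ^+ n * pcoord i x ^+ 2) <= 4 * n.+2%:R * n.+1%:R * 1.
    by rewrite ler_wpM2l ?mulr_ge0// -[leRHS]mulr1 ler_pM.
  have Dp : 0 <= 2 * n.+2%:R * sqn x ^+ n.+1 + 4 * n.+2%:R * n.+1%:R * sqn x ^+ n * pcoord i x ^+ 2.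
    by apply: addr_ge0; [apply: mulr_ge0|apply: (mulr_ge0 _ c0); apply: mulr_ge0]; rewrite // mulr_ge0.
  rewrite /D normrN (ger0_norm Dp).
  rewrite -[X in _ + X]mulrA; move: e2; rewrite n1 => e2.
  apply: le_trans (lerD e1 e2) _; rewrite /C expr2; nra.
have dN (s : R) : 0 < s < 1 -> is_derive s (1 : R) N (N' s).
  move=> _; have := is_deriveB (is_derive_cst (1 : R) s (1 : R)) (is_deriveX n.+2 (is_derive_id s (1:R))).
  have -> : cst 1 - id ^+ n.+2 = N by apply/funext => t; rewrite /N -[LHS]/(1 - (id ^+ n.+2) t) exprfctE.
  by move/is_derive_eq; apply; rewrite sub0r /N' /GRing.scale /= mulr1.
have cN : {within `[0, 1], continuous N}.
  apply: continuous_subspaceT => s; apply: cvgB; [exact: cvg_cst|exact: exprn_continuous].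
have cN' (s : R) : 0 < s < 1 -> {for s, continuous N'}.
  by move=> _; apply: cvgN; apply: cvgM; [exact: cvg_cst|exact: exprn_continuous].
have N1 : N 1 = 0 by rewrite /N expr1n subrr.
have N'C (s : R) : 0 < s < 1 -> `|N' s| <= C.
  move=> /andP[s0 s1]; apply: le_trans (NC s _) _; first by rewrite !ltW.
  by apply: le_trans C2; rewrite ler_peMl//; lra.
have XE : forall (i : bool) (x : R * R), Omega x -> X i x = 2 * pcoord i x * N' (sqn x).
  by move=> i x _; rewrite /X /N' mulrC.
transitivity (intO (fun x => phi x * (D false x + D true x))); last exact: (green_identity gd dN cN N1 N'C cN' cX cD dX XC DC XE).
apply: eq_intO => x _; congr (_ * _); rewrite /D n1.
have sE : pcoord true x ^+ 2 = sqn x - pcoord false x ^+ 2 by rewrite /sqn /pcoord addrAC subrr add0r.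
rewrite sE [sqn x ^+ n.+1]exprS.
by move: (n.+2%:R) (sqn x ^+ n) (sqn x) (pcoord false x) => a b c d; ring.
Qed.

Lemma mean_gt0 : 0 < intO (fun x => u x * phi x).
Proof.
have [_ u04 uneg] := solution_bounds p3 sol rad u0_gt0.
have low := eigenvalue_lower p3 sol rad u0_gt0 gd phi_gt0 phi_eq.
have [M [M0 MM Msmall]] := negative_bound_small p3 u0_gt0.
have p0 : 0 < p by move: p3; lra.
have p1 : 1 < p by move: p3; lra.
have Mmu := lt_le_trans Msmall low.
have mu0 : 0 < mu by apply: le_lt_trans Mmu; rewrite mulr_ge0 ?powR_ge0// mulr_ge0// ltW.
pose n := Num.truncn ((p - 1) * M `^ (p - 1)).
have W0 : 0 <= (p - 1) * M `^ (p - 1) by rewrite mulr_ge0 ?powR_ge0//; lra.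
have nM : (p - 1) * M `^ (p - 1) <= 4 * n.+2%:R ^+ 2.
  have h1 : (p - 1) * M `^ (p - 1) <= n.+1%:R by exact/ltW/truncnS_gt.
  have h2 : n.+1%:R <= n.+2%:R :> R by rewrite ler_nat.
  have h3 : 1 <= n.+2%:R :> R by rewrite ler1n.
  have h4 : n.+2%:R * 1 <= n.+2%:R * n.+2%:R :> R by rewrite ler_wpM2l//; lra.
  have h5 := le_trans h1 h2; rewrite expr2; lra.
clearbody n.
have [phi1 _ g1] := green_data_L1 gd.
have bu := bmeas_u sol.
have ba : bmeas (fun x => `|u x| `^ (p - 1)) by apply: bmeas_powR_norm => //; lra.
have bV : bmeas (fun x => mu - p * `|u x| `^ (p - 1)).
  by apply: bmeasB; [exact: bmeas_cst|apply: bmeasM => //; exact: bmeas_cst].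
have bq k : bmeas (fun x : R * R => sqn x ^+ k).
  apply: (@continuous_bmeas _ _ 1) => x Ox.
    apply: (@continuous_comp _ _ _ (@sqn R) (fun t => t ^+ k)).
      exact: continuous_sqn.
    exact: exprn_continuous.
  by move/OmegaP: Ox => /ltW h; rewrite ger0_norm ?exprn_ge0 ?sqn_ge0// exprn_ile1// sqn_ge0.
have bau : bmeas (fun x => `|u x| `^ (p - 1) * u x) by exact: bmeasM.
have bth : bmeas (fun x : R * R => 1 - sqn x ^+ n.+2).
  by apply: bmeasB; [exact: bmeas_cst|exact: bq].
have bt : bmeas (fun x : R * R => 4 * n.+2%:R ^+ 2 * sqn x ^+ n.+1).
  by apply: bmeasM; [exact: bmeas_cst|exact: bq].
have bVu : bmeas (fun x => (mu - p * `|u x| `^ (p - 1)) * u x) by exact: bmeasM.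
have bVth : bmeas (fun x => (mu - p * `|u x| `^ (p - 1)) * (1 - sqn x ^+ n.+2)) by exact: bmeasM.
have E1 := green_solution; rewrite (intO_lapl p3 sol gd phi_eq bu) in E1.
have E2 := green_power n; rewrite (intO_lapl p3 sol gd phi_eq bth) in E2.
pose B x := (p - 1) * (`|u x| `^ (p - 1) * u x) + M * (4 * n.+2%:R ^+ 2 * sqn x ^+ n.+1 +
   (mu - p * `|u x| `^ (p - 1)) * (1 - sqn x ^+ n.+2)).
have bB : bmeas B.
  by apply: bmeasD; apply: bmeasM; [exact: bmeas_cst|exact: bau|exact: bmeas_cst|exact: bmeasD].
have bN k : bmeas k -> bmeas (fun x => - k x).
  by move=> bk; apply: bmeas_eq (bmeasM (bmeas_cst (-1)) bk) => x _; rewrite mulN1r.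
have B0 x : Omega x -> 0 < B x.
  move=> Ox; have /OmegaP x1 := Ox; have x0 := sqn_ge0 x.
  have s1 : sqn x ^+ n.+2 < 1 by rewrite exprn_ilt1.
  apply: bracket_gt0 => //.
  - by rewrite exprn_ge0.
  - by rewrite subr_gt0 s1 /= gerBl exprn_ge0.
  - by rewrite subKr exprS ler_piMl ?exprn_ge0// ltW.
  move=> un; have := uneg x Ox un; rewrite -MM => h.
  rewrite leNgt; apply/negP => Mu; move: h; rewrite leNgt => /negP; apply.
  have pp : 0 < p + 1 by rewrite addr_gt0.
  by apply: (gt0_ltr_powR pp); [exact: ltW|exact: normr_ge0|].
have E : mu * intO (fun x => u x * phi x) = intO (fun x => phi x * B x).
  have Lu : L1 (fun x => u x * phi x) by apply: L1_eq (L1M phi1 bu) => x _; rewrite mulrC.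
  rewrite -intOZ//.
  (* [F1] and [F2] are the defects of Green's formula for [u] and for the barrier, both of integral
     0; pointwise, mu u phi = phi B + F1 + M F2. *)
  pose F1 x := phi x * ((mu - p * `|u x| `^ (p - 1)) * u x) - phi x * - (`|u x| `^ (p - 1) * u x).
  pose F2 x := phi x * - (4 * n.+2%:R ^+ 2 * sqn x ^+ n.+1) -
    phi x * ((mu - p * `|u x| `^ (p - 1)) * (1 - sqn x ^+ n.+2)).
  have L11 := L1M phi1 bVu; have L12 := L1M phi1 (bN _ bau).
  have L21 := L1M phi1 (bN _ bt); have L22 := L1M phi1 bVth.
  have LF1 : L1 F1 := L1B L11 L12.
  have LF2 : L1 F2 := L1B L21 L22.
  have LB := L1M phi1 bB.
  have Z1 : intO F1 = 0 by rewrite [LHS](intOB L11 L12) E1 subrr.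
  have Z2 : intO F2 = 0 by rewrite [LHS](intOB L21 L22) E2 subrr.
  transitivity (intO (fun x => (phi x * B x + F1 x) + M * F2 x)).
    by apply: eq_intO => x _; rewrite /B /F1 /F2; ring.
  rewrite (intOD (L1D LB LF1) (L1Z M LF2)) (intOD LB LF1) (intOZ M LF2).
  by rewrite Z1 Z2 mulr0 !addr0.
suff : 0 < mu * intO (fun x => u x * phi x) by rewrite pmulr_rgt0.
rewrite E; apply: intO_gt0; first exact: L1M.
  by apply: ae_imply phi_gt0 => x h Ox; rewrite mulr_ge0 ?ltW ?h ?B0.
move=> H; apply: phi_n0; apply: ae_imply H => x h Ox.
by have /eqP := h Ox; rewrite mulf_eq0 (gt_eqF (B0 x Ox)) orbF => /eqP.
Qed.

End PositiveMean.

Unset Implicit Arguments.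

Theorem theorem1p3 (R : realType) (K : nat) (hK : (2 <= K)%N) :
  exists pstar : R, forall p : R, 1 < p -> pstar < p ->
    forall u phi1 : R * R -> R,
      lane_emden_solution p u ->
      radial u ->
      (nodal_regions u #= `I_K)%card ->
      0 < u (0, 0) ->
      first_eigenfunction p u phi1 ->
      {ae leb2, forall x, Omega x -> 0 < phi1 x} ->
      0 < \int[leb2]_(x in Omega) (u x * phi1 x).
Proof.
exists (300 * 300) => p _ pstar u phi1 sol rad _ u0 [lambda [[op phi_n0] _]] phi_gt0.
have [_ [L2phi [G [wG appr]]] _ [g [wg eqn]]] := op.
(* The operator carries a minus sign on the Laplacian, so [mu] is the opposite of the eigenvalue. *)
apply: (@mean_gt0 _ p (- lambda) u phi1 G g) => //.
apply: ae_imply eqn => x h Ox; have := h Ox.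
rewrite big_bool /= => E; apply/eqP; rewrite -subr_eq0; apply/eqP.
rewrite mulrBl mulNr E; ring.
Qed.
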